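(* Let $\mathbb{K}=\mathbb{R}$ or $\mathbb{C}$, let $m$ and $n_1,\ldots,n_m$ be fixed positive integers, and let $p\in(0,\infty)$. The following assertions are equivalent: (i) There is a constant $C_{n_1,\ldots,n_m}\ge 1$ such that $$\left(\sum_{|\alpha^{(1)}|=n_1,\ldots,|\alpha^{(m)}|=n_m}\left|c_{\alpha^{(1)}\ldots\alpha^{(m)}}(P)\right|^{p}\right)^{\frac1p}\le C_{n_1,\ldots,n_m}\,\|P\|$$ for all continuous $(n_1,\ldots,n_m)$-homogeneous polynomials $P:\underbrace{c_0\times\cdots\times c_0}_{m}\to\mathbb{K}$. (ii) $$p\ge \frac{2\left(\sum_{j=1}^m n_j\right)}{\left(\sum_{j=1}^m n_j\right)+1}.$$
   Context: Here $c_0$ is the Banach space of null sequences in $\mathbb{K}$ with the sup norm. For normed spaces $E,F$ over $\mathbb{K}$ and a positive integer $n$, a map $R:E\to F$ is an $n$-homogeneous polynomial if there is an $n$-linear map $A:E\times\cdots\times E\to F$ with $R(x)=A(x,\ldots,x)$ for all $x\in E$. For normed spaces $E_1,\ldots,E_m,F$, a map $P:E_1\times\cdots\times E_m\to F$ is an $(n_1,\ldots,n_m)$-homogeneous polynomial if for each $i=1,\ldots,m$ and all fixed $x_k\in E_k$ ($k\ne i$), the map $P(x_1,\ldots,x_{i-1},\cdot,x_{i+1},\ldots,x_m):E_i\to F$ is an $n_i$-homogeneous polynomial. Its norm is $$\|P\|=\sup\{\|P(x_1,\ldots,x_m)\| : x_i\in E_i,\ \max_i\|x_i\|\le 1\}.$$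 A multi-index is a sequence $\alpha=(\alpha_j)_{j=1}^\infty$ in $\mathbb{N}\cup\{0\}$ with $|\alpha|:=\sum_j\alpha_j<\infty$, and for a scalar sequence $x$ one writes $x^\alpha:=\prod_j x_j^{\alpha_j}$. For a continuous $(n_1,\ldots,n_m)$-homogeneous polynomial $P:c_0\times\cdots\times c_0\to\mathbb{K}$, the scalars $c_{\alpha^{(1)}\ldots\alpha^{(m)}}(P)$ are the coefficients in its monomial expansion $$P(x^{(1)},\ldots,x^{(m)})=\sum_{|\alpha^{(1)}|=n_1,\ldots,|\alpha^{(m)}|=n_m}c_{\alpha^{(1)}\ldots\alpha^{(m)}}(P)\,(x^{(1)})^{\alpha^{(1)}}\cdots(x^{(m)})^{\alpha^{(m)}};$$ they are uniquely determined by this identity for finitely supported $x^{(1)},\ldots,x^{(m)}$ (where only finitely many terms are nonzero). *)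

(* Defs.v *)
From HB Require Import structures.
From mathcomp Require Import all_boot all_order all_algebra finmap complex.
From mathcomp Require Import all_classical all_reals all_analysis.
Set Implicit Arguments.
Unset Strict Implicit.
Unset Printing Implicit Defensive.
Import Order.TTheory GRing.Theory Num.Theory.
Import numFieldNormedType.Exports.
Local Open Scope classical_set_scope.
Local Open Scope ring_scope.

Variant scalar_kind := RealScalars | ComplexScalars.

Definition scalars (R : realType) (k : scalar_kind) : numFieldType :=
  match k with RealScalars => R | ComplexScalars => R[i] end.

(* The norm of a numFieldType takes its values in the field itself; modulus is
   the absolute value read as a real number. *)
Definition modulus (R : realType) (k : scalar_kind) : scalars R k -> R :=
  match k with
  | RealScalars => fun x : R => `|x|
  | ComplexScalars => @Normc.normc R
  end.

Lemma modulusE (R : realType) (z : scalars R ComplexScalars) :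
  ((modulus z)%:C)%C = `|z| :> R[i].
Proof. by case: z. Qed.

Section NullSequences.
Variable K : numFieldType.

Definition null_sequence : {pred (nat -> K^o)} :=
  fun x => `[< x j @[j --> \oo] --> (0 : K^o) >].

Record c0 := C0 { c0_val : nat -> K^o; c0_valP : c0_val \in null_sequence }.

HB.instance Definition _ := [isSub for c0_val].
HB.instance Definition _ := [Choice of c0 by <:].

Lemma null_sequence_submod : subsemimod_closed null_sequence.
Proof.
split; last first.
  move=> a x /asboolP x0; apply/asboolP.
  by rewrite -(scaler0 _ a); apply: cvgZl_tmp x0.
split; first by apply/asboolP; apply: cvg_cst.
move=> x y /asboolP x0 /asboolP y0; apply/asboolP.
by rewrite -(addr0 (0 : K^o)); apply: cvgD.
Qed.

HB.instance Definition _ :=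
  GRing.isSubSemiModClosed.Build K (nat -> K^o) null_sequence
    null_sequence_submod.
HB.instance Definition _ := [SubChoice_isSubLmodule of c0 by <:].

(* The supremum is taken in K itself, which is only partially ordered when K is
   the field of complex numbers; c0_norm_attained shows that it exists. *)
Definition c0_norm (x : c0) : K := supremum 0 (range (fun j => `|c0_val x j|)).

Lemma c0_norm_attained (x : c0) :
  exists2 j, c0_norm x = `|c0_val x j| & forall i, `|c0_val x i| <= c0_norm x.
Proof.
have [j maxj] : exists j, forall i, `|c0_val x i| <= `|c0_val x j|.
  have upto M : exists j, forall i, (i <= M)%N -> `|c0_val x i| <= `|c0_val x j|.
    elim: M => [|M [j jmax]]; first by exists 0%N => i; rewrite leqn0 => /eqP ->.
    have [le_j|lt_j] :=
      real_leP (normr_real (c0_val x M.+1)) (normr_real (c0_val x j)).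
      by exists j => i; rewrite leq_eqVlt => /orP[/eqP -> //|]; apply: jmax.
    exists M.+1 => i; rewrite leq_eqVlt => /orP[/eqP -> //|iM].
    by apply: le_trans (ltW lt_j); apply: jmax.
  have [allz|/existsNP[j0 /eqP xj0]] := pselect (forall j, c0_val x j = 0).
    by exists 0%N => i; rewrite !allz.
  have /asboolP x0 := c0_valP x.
  have [N _ HN] : \forall j \near \oo, `|c0_val x j| < `|c0_val x j0|.
    by apply: (cvgr0_norm_lt (V := K^o) _ x0); rewrite normr_gt0.
  have [j jmax] := upto (maxn N j0); exists j => i.
  have [le_i|lt_i] := leqP i (maxn N j0); first exact: jmax.
  apply: le_trans (jmax j0 (leq_maxr _ _)); apply/ltW/HN.
  exact: leq_trans (leq_maxl _ _) (ltnW lt_i).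
suff -> : c0_norm x = `|c0_val x j| by exists j.
rewrite /c0_norm /supremum ifF; last first.
  by apply/negbTE/set0P; exists `|c0_val x j|, j.
apply: xget_unique => [|y [ub_y lub_y]].
  by split=> [_ [i _ <-]|y ub_y]; [exact: maxj | apply: ub_y; exists j].
apply/le_anti/andP; split; last by apply: ub_y; exists j.
by apply: lub_y => _ [i _ <-]; exact: maxj.
Qed.

Lemma le_c0_norm (x : c0) i : `|c0_val x i| <= c0_norm x.
Proof. by have [j _] := c0_norm_attained x. Qed.

Lemma ler_c0_normD (x y : c0) : c0_norm (x + y) <= c0_norm x + c0_norm y.
Proof.
have [j -> _] := c0_norm_attained (x + y).
by apply: le_trans (ler_normD _ _) _; rewrite lerD ?le_c0_norm.
Qed.

Lemma c0_normZ (a : K) (x : c0) : c0_norm (a *: x) = `|a| * c0_norm x.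
Proof.
have [j ej _] := c0_norm_attained (a *: x); have [i ei _] := c0_norm_attained x.
apply/le_anti/andP; split.
  by rewrite ej normrZ ler_wpM2l ?le_c0_norm.
by rewrite ei -normrZ; apply: (le_c0_norm (a *: x) i).
Qed.

Lemma c0_norm0_eq0 (x : c0) : c0_norm x = 0 -> x = 0.
Proof.
move=> x0; apply/val_inj/funext => i; apply/eqP.
by rewrite -normr_le0 -x0 le_c0_norm.
Qed.

HB.instance Definition _ :=
  Lmodule_isNormed.Build K c0 ler_c0_normD c0_normZ c0_norm0_eq0.

End NullSequences.

Section HomogeneousPolynomials.
Variable K : numFieldType.

Definition multilinear (n : nat) (E F : normedModType K)
    (A : ('I_n -> E) -> F) :=
  forall (i : 'I_n) (x : 'I_n -> E), linear (fun t : E => A (dfwith x i t)).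

(* As is usual for this notion, A is not required to be continuous. *)
Definition homogeneous_polynomial (n : nat) (E F : normedModType K)
    (Q : E -> F) :=
  exists2 A : ('I_n -> E) -> F, multilinear A & forall x, Q x = A (fun=> x).

Definition multihomogeneous_polynomial (m : nat) (n : 'I_m -> nat)
    (E : 'I_m -> normedModType K) (F : normedModType K)
    (P : (forall i, E i) -> F) :=
  forall (i : 'I_m) (x : forall i, E i),
    homogeneous_polynomial (n i) (fun t : E i => P (dfwith x i t)).

End HomogeneousPolynomials.

Definition multiindex := {fsfun nat -> nat with 0%N}.

Definition multiindex_deg (a : multiindex) : nat := (\sum_(j <- finsupp a) a j)%N.

Definition monomial (K : numFieldType) (x : nat -> K) (a : multiindex) : K :=
  \prod_(j <- finsupp a) x j ^+ a j.

Definition multidegree (m : nat) (n : 'I_m -> nat) : set ('I_m -> multiindex) :=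
  [set a | forall i, multiindex_deg (a i) = n i].

Section Coefficients.
Variables (K : numFieldType) (m : nat).

(* For finitely supported arguments only finitely many terms are nonzero, so the
   sum below is a finite sum. *)
Definition monomial_expansion (n : 'I_m -> nat) (P : ('I_m -> c0 K) -> K)
    (c : ('I_m -> multiindex) -> K) :=
  forall x : 'I_m -> c0 K,
    (forall i, finite_set [set j | c0_val (x i) j != 0]) ->
    P x = \sum_(a \in multidegree n) c a * \prod_i monomial (c0_val (x i)) (a i).

(* The expansion of a multihomogeneous polynomial of multidegree n exists and
   determines c on multidegree n, the only indices at which coefficient n P is
   meant to be read; the default value of xget is then not used. *)
Definition coefficient (n : 'I_m -> nat) (P : ('I_m -> c0 K) -> K) :
    ('I_m -> multiindex) -> K :=
  xget (fun=> 0) [set c | monomial_expansion n P c].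

End Coefficients.

Definition poly_norm (R : realType) (k : scalar_kind) (m : nat)
    (P : ('I_m -> c0 (scalars R k)) -> scalars R k) : \bar R :=
  ereal_sup [set (modulus (P x))%:E | x in [set x | forall i, `|x i| <= 1]].

(* Main.v *)
Require Import Defs.
From HB Require Import structures.
From mathcomp Require Import all_fingroup ring lra zify.
From mathcomp Require Import all_boot all_order all_algebra finmap complex.
From mathcomp Require Import all_classical all_reals all_analysis.
Set Implicit Arguments.
Unset Strict Implicit.
Unset Printing Implicit Defensive.
Import Order.TTheory GRing.Theory Num.Theory.
Import numFieldNormedType.Exports.
Local Open Scope classical_set_scope.
Local Open Scope ring_scope.

(** Write M = n_1 + ... + n_m. Both directions pass through the slots (i, k) with
    k < n_i, of which there are M, and through the words that put a coordinate
    in every slot: restricted to finitely supported arguments, P is a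
    combination of the products over the slots (i, k) of the coordinate of x_i
    that the word puts there.

    Why M-linear estimates bound the coefficients of P. Such a word expansion
    exists although P is only assumed to be polynomial in each variable
    separately and no symmetry is available ([separate_to_joint],
    [multihomogeneous_expansion]). Summing P over all choices of signs of one
    vector per slot, with the product of the signs as weight, gives a form that
    is linear in each slot ([polarization_multilinear]) and is bounded on sign
    vectors by a constant times the norm of P. Its values at unit vectors are
    positive integer multiples of the coefficients of P ([coefficient_polarized]), so
    it is enough to bound sums of powers of the entries of a finite array that
    is bounded on sign vectors, uniformly in the size of the array. Real and
    imaginary parts reduce this to real arrays.

    The real array a. Fixing the index in one slot l, Khinchine's inequality
    for products of independent signs ([khinchine], through the fourth moment)
    compares the Euclidean norm b_l(t) of the entries whose index in slot l is t
    with the mean absolute value of a random sum; choosing the signs of slot l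
    last, the sum over t of b_l(t) is at most a constant times the bound of a
    ([slice_norm_sum_le]). If these sums are at most 1, apply the inequality of
    arithmetic and geometric means at each index s to the M + 1 numbers
    prod_l b_l(s_l) and a_s^2 / b_l(s_l), one for each slot l. Their product is
    |a_s|^(2M), so their mean is at least |a_s|^(2M/(M+1)), while each of them
    has sum at most 1 over s ([blei_sum]). This is the exponent 2M/(M+1).

    Why no smaller exponent works. Multiplying alternately by vectors with
    entries of modulus at most 1 and by a Walsh matrix of size N = 2^r, which is
    sqrt N times an isometry, yields an M-linear form with N^M coefficients, all
    equal to 1 or -1, bounded by N^((M+1)/2) ([walsh_form]). Giving every slot
    its own block of N coordinates turns it into a polynomial of multidegree
    (n_1, ..., n_m) with the same coefficients and no larger norm, so an
    inequality with exponent p forces N^(M/p) <= C N^((M+1)/2) for all N = 2^r. *)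

(** * Means and moments of sums of independent signs *)

Definition consf (T : Type) n (x : T) (f : {ffun 'I_n -> T}) :
    {ffun 'I_n.+1 -> T} :=
  [ffun i => if unlift ord0 i is Some j then f j else x].

Lemma consf0 (T : Type) n (x : T) (f : {ffun 'I_n -> T}) : consf x f ord0 = x.
Proof. by rewrite ffunE unlift_none. Qed.

Lemma consfS (T : Type) n (x : T) (f : {ffun 'I_n -> T}) i :
  consf x f (lift ord0 i) = f i.
Proof. by rewrite ffunE liftK. Qed.

Definition unconsf (T : Type) n (f : {ffun 'I_n.+1 -> T}) :
  T * {ffun 'I_n -> T} := (f ord0, [ffun i => f (lift ord0 i)]).

Lemma consfK (T : Type) n :
  cancel (fun p : T * {ffun 'I_n -> T} => consf p.1 p.2) (@unconsf T n).
Proof.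
move=> [x f] /=; congr pair; first exact: consf0.
by apply/ffunP=> i; rewrite ffunE consfS.
Qed.

Lemma unconsfK (T : Type) n :
  cancel (@unconsf T n) (fun p : T * {ffun 'I_n -> T} => consf p.1 p.2).
Proof.
move=> f; apply/ffunP=> i; rewrite ffunE.
by case: unliftP => [j|] ->; rewrite ?ffunE.
Qed.

Lemma consf_bij (T : Type) n :
  bijective (fun p : T * {ffun 'I_n -> T} => consf p.1 p.2).
Proof. by exists (@unconsf T n); [exact: consfK|exact: unconsfK]. Qed.

Lemma unconsf_bij (T : Type) n : bijective (@unconsf T n).
Proof.
by exists (fun p => consf p.1 p.2); [exact: unconsfK|exact: consfK].
Qed.

Lemma enumf_bij (L : finType) (T : Type) :
  bijective (fun f : {ffun L -> T} => [ffun i : 'I_#|L| => f (enum_val i)]).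
Proof.
exists (fun g : {ffun 'I_#|L| -> T} => [ffun l => g (enum_rank l)]) => f;
  by apply/ffunP=> i; rewrite !ffunE ?enum_rankK ?enum_valK.
Qed.

Section Moments.
Variable R : realType.
Implicit Types W I J : finType.

Lemma cauchy_schwarz_sum W (f g : W -> R) :
  (\sum_w f w * g w) ^+ 2 <= (\sum_w f w ^+ 2) * (\sum_w g w ^+ 2).
Proof.
set sfg := \sum_w _; set sf := \sum_w f w ^+ 2; set sg := \sum_w g w ^+ 2.
have sg0 : 0 <= sg by apply: sumr_ge0 => w _; rewrite sqr_ge0.
have : 0 <= \sum_w (sg * f w - sfg * g w) ^+ 2.
  by apply: sumr_ge0 => w _; rewrite sqr_ge0.
have -> : \sum_w (sg * f w - sfg * g w) ^+ 2 = sg * (sf * sg - sfg ^+ 2).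
  transitivity (\sum_w (sg ^+ 2 * f w ^+ 2 - 2 * sg * sfg * (f w * g w)
      + sfg ^+ 2 * g w ^+ 2)); first by apply: eq_bigr => w _; ring.
  rewrite big_split sumrB -!mulr_sumr -/sf -/sg -/sfg /=; ring.
move: sg0; rewrite le_eqVlt => /predU1P[sg0 _|sg_gt0]; last first.
  by rewrite pmulr_rge0 // subr_ge0.
suff -> : sfg = 0 by rewrite -sg0 mulr0 expr0n.
rewrite /sfg big1 // => w _; suff -> : g w = 0 by rewrite mulr0.
apply/eqP; rewrite -sqrf_eq0; apply/eqP/(psumr_eq0P _ (esym sg0)) => //.
by move=> v _; rewrite sqr_ge0.
Qed.

Definition mean W (f : W -> R) : R := (\sum_w f w) / #|W|%:R.

Lemma eq_mean W (f g : W -> R) : f =1 g -> mean f = mean g.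
Proof. by move=> fg; rewrite /mean (eq_bigr g). Qed.

Lemma le_mean W (f g : W -> R) : (forall w, f w <= g w) -> mean f <= mean g.
Proof. by move=> fg; rewrite ler_wpM2r ?invr_ge0 ?ler0n // ler_sum. Qed.

Lemma mean_ge0 W (f : W -> R) : (forall w, 0 <= f w) -> 0 <= mean f.
Proof. by move=> f0; rewrite divr_ge0 ?ler0n // sumr_ge0. Qed.

Lemma meanZ W (a : R) (f : W -> R) : mean (fun w => a * f w) = a * mean f.
Proof. by rewrite /mean -mulr_sumr mulrA. Qed.

Lemma meanD W (f g : W -> R) : mean (fun w => f w + g w) = mean f + mean g.
Proof. by rewrite /mean big_split mulrDl. Qed.

Lemma mean_sum W I (f : I -> W -> R) :
  mean (fun w => \sum_i f i w) = \sum_i mean (f i).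
Proof. by rewrite /mean exchange_big /= mulr_suml. Qed.

Lemma sum_pair I J (f : I * J -> R) : \sum_p f p = \sum_i \sum_j f (i, j).
Proof. by rewrite pair_bigA; apply: eq_bigr => -[]. Qed.

Lemma mean_pair W W' (f : W * W' -> R) :
  mean f = mean (fun w' => mean (fun w => f (w, w'))).
Proof.
rewrite /mean card_prod natrM invfM sum_pair exchange_big -mulr_suml /=.
by rewrite mulrA.
Qed.

Lemma mean_bij W W' (g : W' -> W) (f : W -> R) :
  bijective g -> mean f = mean (f \o g).
Proof.
move=> bg; rewrite /mean (bij_eq_card bg); congr (_ / _).
by rewrite (reindex g) //; apply: onW_bij.
Qed.

Lemma mean_cst W (w0 : W) (a : R) : mean (fun _ : W => a) = a.
Proof.
rewrite /mean sumr_const -[a *+ _]mulr_natr mulfK // pnatr_eq0 -lt0n.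
by apply/card_gt0P; exists w0.
Qed.

Lemma mean_cauchy_schwarz W (f g : W -> R) :
  mean (fun w => f w * g w) ^+ 2 <=
  mean (fun w => f w ^+ 2) * mean (fun w => g w ^+ 2).
Proof.
rewrite /mean expr_div_n mulrACA -invfM -expr2 ler_wpM2r ?invr_ge0 ?sqr_ge0 //.
exact: cauchy_schwarz_sum.
Qed.

(** The family X behaves like independent signs up to fourth moments: it is
    orthonormal for the uniform mean on W, and the fourth moment of every
    combination is controlled by the square of its second moment. *)
Definition moments (D : R) W I (X : I -> W -> R) := forall a : I -> R,
  mean (fun w => (\sum_i a i * X i w) ^+ 2) = \sum_i a i ^+ 2 /\
  mean (fun w => (\sum_i a i * X i w) ^+ 4) <= D * (\sum_i a i ^+ 2) ^+ 2.

Lemma eq_moments D W I (X Y : I -> W -> R) :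
  (forall i w, X i w = Y i w) -> moments D X -> moments D Y.
Proof.
move=> XY mX a; have [m2 m4] := mX a.
have E w : \sum_i a i * Y i w = \sum_i a i * X i w.
  by apply: eq_bigr => i _; rewrite XY.
split; first by rewrite -m2; apply: eq_mean => w; rewrite E.
by apply: le_trans m4; apply: le_mean => w; rewrite E.
Qed.

Lemma moments_bij D W I W' I' (X : I -> W -> R) (f : I' -> I) (g : W' -> W) :
  bijective f -> bijective g -> moments D X ->
  moments D (fun i' w' => X (f i') (g w')).
Proof.
move=> bf bg mX a; have [f' fK f'K] := bf.
have eS w : \sum_i' a i' * X (f i') w = \sum_i a (f' i) * X i w.
  rewrite [RHS](reindex f) /=; last exact: onW_bij.
  by apply: eq_bigr => i _; rewrite fK.
have eA : \sum_i' a i' ^+ 2 = \sum_i a (f' i) ^+ 2.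
  rewrite [RHS](reindex f) /=; last exact: onW_bij.
  by apply: eq_bigr => i _; rewrite fK.
have [m2 m4] := mX (a \o f').
rewrite eA; split.
  by rewrite -[RHS]m2 (mean_bij _ bg); apply: eq_mean => w /=; rewrite eS.
apply: le_trans m4; rewrite [leRHS](mean_bij _ bg) le_eqVlt; apply/orP; left.
by apply/eqP/eq_mean => w /=; rewrite eS.
Qed.

(** For fixed w', the sum over i is a combination of the X i with coefficients
    g i w'; its fourth moment brings in the products g i w' ^ 2 * g j w' ^ 2,
    whose means the Cauchy-Schwarz inequality reduces to fourth moments of
    combinations of Y. The constants therefore multiply. *)
Lemma moments_tensor D D' W W' I I' (X : I -> W -> R) (Y : I' -> W' -> R) :
  0 <= D -> 0 <= D' -> moments D X -> moments D' Y ->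
  moments (D * D') (fun (i : I * I') (w : W * W') => X i.1 w.1 * Y i.2 w.2).
Proof.
move=> D0 D0' mX mY a.
pose g i w' := \sum_j a (i, j) * Y j w'.
pose s i := \sum_j a (i, j) ^+ 2.
have s0 i : 0 <= s i by apply: sumr_ge0 => j _; rewrite sqr_ge0.
have eS w w' : \sum_i a i * (X i.1 w * Y i.2 w') = \sum_i g i w' * X i w.
  rewrite sum_pair /=.
  apply: eq_bigr => i _; rewrite mulr_suml; apply: eq_bigr => j _; ring.
have eA : \sum_i a i ^+ 2 = \sum_i s i.
  exact: sum_pair.
rewrite eA !mean_pair; split.
  rewrite (@eq_mean _ _ (fun w' => \sum_i g i w' ^+ 2)) => [|w'].
    by rewrite mean_sum; apply: eq_bigr => i _; rewrite (mY _).1.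
  by rewrite -(mX (g^~ w')).1; apply: eq_mean => w /=; rewrite eS.
apply: (@le_trans _ _ (mean (fun w' => D * (\sum_i g i w' ^+ 2) ^+ 2))).
  apply: le_mean => w'; apply: le_trans (mX (g^~ w')).2.
  by apply: le_mean => w /=; rewrite eS.
rewrite meanZ -mulrA ler_wpM2l //.
pose G i j w' := g i w' ^+ 2 * g j w' ^+ 2.
rewrite (@eq_mean _ _ (fun w' => \sum_i \sum_j G i j w')) => [|w']; last first.
  by rewrite expr2 mulr_suml; apply: eq_bigr => i _; rewrite mulr_sumr.
rewrite mean_sum expr2 mulr_suml mulr_sumr ler_sum // => i _.
rewrite mean_sum mulr_sumr mulr_sumr ler_sum // => j _.
have g4 l : 0 <= mean (fun w' => (g l w' ^+ 2) ^+ 2) <= D' * s l ^+ 2.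
  rewrite mean_ge0 => [|w']; last exact: sqr_ge0.
  by rewrite (le_trans _ (mY _).2) // le_mean // => w'; rewrite -exprM.
have [/andP[i0 iD] /andP[j0 jD]] := (g4 i, g4 j).
have G0 : 0 <= mean (G i j) by apply: mean_ge0 => w'; rewrite mulr_ge0 ?sqr_ge0.
rewrite -(@ler_pXn2r _ 2) ?nnegrE ?(mulr_ge0 D0' (mulr_ge0 (s0 i) (s0 j))) //.
apply: le_trans (mean_cauchy_schwarz _ _) _.
have -> : (D' * (s i * s j)) ^+ 2 = D' * s i ^+ 2 * (D' * s j ^+ 2) by ring.
exact: ler_pM.
Qed.

Lemma moments_pow D W I (X : I -> W -> R) n : 0 <= D -> moments D X ->
  moments (D ^+ n) (fun (s : {ffun 'I_n -> I}) (w : {ffun 'I_n -> W}) =>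
    \prod_l X (s l) (w l)).
Proof.
move=> D0 mX; elim: n => [|n IHn].
  move=> a; pose s0 : {ffun 'I_0 -> I} := ffun0 (card_ord 0).
  pose w0 : {ffun 'I_0 -> W} := ffun0 (card_ord 0).
  have S1 F : \sum_(s : {ffun 'I_0 -> I}) F s = F s0 :> R.
    rewrite (bigD1 s0) //= big1 ?addr0 // => s /eqP[].
    by apply/ffunP=> -[].
  have E w : \sum_(s : {ffun 'I_0 -> I}) a s * \prod_l X (s l) (w l) = a s0.
    by rewrite S1 big_ord0 mulr1.
  rewrite expr0 mul1r !S1; split.
    by rewrite -(mean_cst w0 (a s0 ^+ 2)); apply: eq_mean => w; rewrite E.
  by rewrite -exprM -(mean_cst w0 (_ ^+ _)) le_mean // => w; rewrite E.
have := moments_bij (unconsf_bij I n) (unconsf_bij W n)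
  (moments_tensor D0 (exprn_ge0 n D0) mX IHn).
rewrite -exprS; apply: eq_moments => s w /=.
by rewrite big_ord_recl; congr (_ * _); apply: eq_bigr => i _; rewrite !ffunE.
Qed.

(** The fourth moment of a0 * sign + f is a0^4 + 6 a0^2 E f^2 + E f^4, because
    odd powers of the sign have mean 0; the constant 3 is stable under this
    recursion. *)
Lemma moments_rademacher n :
  moments 3 (fun (i : 'I_n) (w : {ffun 'I_n -> bool}) => (-1) ^+ w i).
Proof.
elim: n => [|n IHn] a.
  pose w0 : {ffun 'I_0 -> bool} := [ffun=> true].
  rewrite !big_ord0 expr0n mulr0; split.
    by rewrite -{2}(mean_cst w0 0); apply: eq_mean => w; rewrite big_ord0 expr0n.
  by rewrite -{2}(mean_cst w0 0) le_mean // => w; rewrite big_ord0 expr0n.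
pose f (w : {ffun 'I_n -> bool}) := \sum_i a (lift ord0 i) * (-1) ^+ w i : R.
have E (p : bool) w : \sum_i a i * (-1) ^+ (consf p w i : bool) = a ord0 * (-1) ^+ p + f w.
  by rewrite big_ord_recl consf0; under eq_bigr do rewrite consfS.
have mb (g : bool -> R) : mean g = (g true + g false) / 2.
  by rewrite /mean card_bool big_bool.
have [m2 m4] := IHn (fun i => a (lift ord0 i)).
pose s := \sum_i a (lift ord0 i) ^+ 2; rewrite -/s in m2 m4.
have s0 : 0 <= s by apply: sumr_ge0 => j _; rewrite sqr_ge0.
rewrite !(mean_bij _ (consf_bij bool n)) !mean_pair /= big_ord_recl -/s; split.
  rewrite (@eq_mean _ _ (fun w => a ord0 ^+ 2 + f w ^+ 2)) => [|w].
    by rewrite meanD -m2 (mean_cst [ffun=> true]).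
  by rewrite mb !E expr1 expr0; field.
rewrite (@eq_mean _ _ (fun w => a ord0 ^+ 4 + (6 * a ord0 ^+ 2 * f w ^+ 2 + f w ^+ 4))).
  rewrite !meanD meanZ (mean_cst [ffun=> true]) m2.
  have := sqr_ge0 (a ord0); have := sqr_ge0 (a ord0 ^+ 2).
  move: m4; rewrite -exprM; set m := mean _; nra.
by move=> w; rewrite mb !E expr1 expr0; field.
Qed.

(** A random variable whose fourth moment is comparable to the square of its
    second moment cannot have a small first moment. The threshold t of the proof
    is chosen so that values beyond t contribute at most half of the second
    moment. *)
Lemma khinchine D W I (X : I -> W -> R) (a : I -> R) : 0 < D -> moments D X ->
  Num.sqrt (\sum_i a i ^+ 2) <=
  2 * Num.sqrt (2 * D) * mean (fun w => `|\sum_i a i * X i w|).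
Proof.
move=> D0 mX; have [m2 m4] := mX a; pose f w := \sum_i a i * X i w.
set v := \sum_i a i ^+ 2 in m2 m4 *.
rewrite -[mean _]/(mean (fun w => `|f w|)).
have v0 : 0 <= v by apply: sumr_ge0 => i _; rewrite sqr_ge0.
have mf0 : 0 <= mean (fun w => `|f w|) by apply: mean_ge0 => w.
have [->|v_neq0] := eqVneq v 0.
  by rewrite sqrtr0 mulr_ge0 // mulr_ge0 ?sqrtr_ge0 ?ler0n.
have {}v0 : 0 < v by rewrite lt_def v_neq0.
pose t := Num.sqrt (2 * D) * Num.sqrt v.
have t2 : t ^+ 2 = 2 * D * v by rewrite exprMn !sqr_sqrtr ?ltW ?mulr_gt0.
have t0 : 0 < t by rewrite mulr_gt0 // sqrtr_gt0 ?mulr_gt0.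
(* x^2 <= t |x| when |x| <= t, and x^2 <= x^4 / t^2 otherwise *)
have pw x : x ^+ 2 <= t * `|x| + (t ^+ 2)^-1 * x ^+ 4.
  have [xt|tx] := leP `|x| t.
    rewrite -{1}(real_normK (num_real x)) expr2 -[leLHS]addr0 lerD ?ler_wpM2r //.
    by rewrite mulr_ge0 ?invr_ge0 ?sqr_ge0 // (exprM x 2 2) sqr_ge0.
  rewrite -[leLHS]add0r; apply: lerD; first by rewrite mulr_ge0 ?(ltW t0).
  rewrite ler_pdivlMl ?exprn_gt0 //.
  rewrite (exprM x 2 2) [X in _ <= X]expr2 ler_wpM2r ?sqr_ge0 //.
  by rewrite -(real_normK (num_real x)) ler_pXn2r ?nnegrE ?(ltW t0) // ltW.
have : v <= t * mean (fun w => `|f w|) + (t ^+ 2)^-1 * (D * v ^+ 2).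
  rewrite -{1}m2; apply: le_trans (le_mean (fun w => pw (f w))) _.
  by rewrite meanD !meanZ lerD2l ler_wpM2l ?invr_ge0 ?sqr_ge0.
have -> : (t ^+ 2)^-1 * (D * v ^+ 2) = v / 2.
  by rewrite t2; field; rewrite !gt_eqF.
move=> vle.
have : v <= 2 * t * mean (fun w => `|f w|) by lra.
rewrite -{1}(sqr_sqrtr (ltW v0)) /t expr2 => h.
rewrite -(ler_pM2r (x := Num.sqrt v)) ?sqrtr_gt0 //; apply: le_trans h _.
by rewrite le_eqVlt; apply/orP; left; apply/eqP; ring.
Qed.

End Moments.

(** * Arrays of real numbers that are bounded on sign vectors *)

Section Arrays.
Variable R : realType.
Variables L T : finType.
Local Notation M := #|L|.

Lemma moments_chaos :
  moments (3 ^+ M) (fun (s : {ffun L -> T}) (w : {ffun L -> {ffun T -> bool}}) =>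
    \prod_l (-1) ^+ w l (s l) : R).
Proof.
have mT : moments 3 (fun (t : T) (w : {ffun T -> bool}) => (-1) ^+ w t : R).
  apply: eq_moments (moments_bij (f := @enum_rank T) (enum_rank_bij T)
    (enumf_bij T bool) (@moments_rademacher R #|T|)) => t w.
  by rewrite ffunE enum_rankK.
have D0 : 0 <= 3 :> R by [].
apply: eq_moments (moments_bij (enumf_bij L T) (enumf_bij L {ffun T -> bool})
  (moments_pow (n := M) D0 mT)) => s w.
rewrite [RHS](reindex (@enum_val L predT)) /=; last first.
  by exists enum_rank => l _; rewrite ?enum_rankK ?enum_valK.
by apply: eq_bigr => i _; rewrite !ffunE.
Qed.

Definition sign_bounded (a : {ffun L -> T} -> R) (B : R) :=
  forall w : {ffun L -> {ffun T -> bool}},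
    `|\sum_(s : {ffun L -> T}) a s * \prod_l (-1) ^+ w l (s l)| <= B.

Definition khinchine_constant : R := 2 * Num.sqrt (2 * 3 ^+ M).

Definition slice_norm (a : {ffun L -> T} -> R) (l : L) (t : T) : R :=
  Num.sqrt (\sum_(s : {ffun L -> T} | s l == t) a s ^+ 2).

(** The signs of slot l only enter the sums S t through a factor of
    absolute value 1, so they may be flipped afterwards to make all the S t
    nonnegative; the sum of the |S t| is then one value of the array at signs. *)
Lemma slice_norm_sum_le a B l : sign_bounded a B ->
  \sum_t slice_norm a l t <= khinchine_constant * B.
Proof.
move=> aB; have D0 : 0 < 3 ^+ M :> R by rewrite exprn_gt0.
pose aj t (s : {ffun L -> T}) := if s l == t then a s else 0.
pose S t (w : {ffun L -> {ffun T -> bool}}) :=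
  \sum_(s : {ffun L -> T}) aj t s * \prod_k (-1) ^+ w k (s k).
apply: (@le_trans _ _ (\sum_t khinchine_constant * mean (fun w => `|S t w|))).
  apply: ler_sum => t _; rewrite /slice_norm.
  rewrite (eq_bigr (fun s => aj t s ^+ 2)) => [|s /eqP st]; last first.
    by rewrite /aj st eqxx.
  rewrite big_mkcond /= (eq_bigr (fun s => aj t s ^+ 2)) => [|s _]; last first.
    by rewrite /aj; case: (s l == t); rewrite ?expr0n.
  exact: khinchine D0 moments_chaos.
rewrite -mulr_sumr ler_wpM2l ?mulr_ge0 ?sqrtr_ge0 ?ler0n // -mean_sum.
pose w0 : {ffun L -> {ffun T -> bool}} := [ffun=> [ffun=> true]].
rewrite -[leRHS](mean_cst w0); apply: le_mean => w.
pose w' : {ffun L -> {ffun T -> bool}} :=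
  [ffun k => [ffun t => w k t (+) ((k == l) && (S t w < 0))]].
apply: le_trans (aB w'); apply: le_trans (ler_norm _).
rewrite le_eqVlt; apply/orP; left; apply/eqP.
transitivity (\sum_t \sum_s (-1) ^+ (S t w < 0)%R *
    (aj t s * \prod_k (-1) ^+ w k (s k)) : R).
  by apply: eq_bigr => t _; rewrite normrEsign mulr_sumr.
rewrite exchange_big; apply: eq_bigr => s _ /=.
rewrite (bigD1 (s l)) //= [X in _ + X]big1 ?addr0 => [|t]; last first.
  move=> ts; have -> : aj t s = 0 by rewrite /aj eq_sym (negPf ts).
  by rewrite mul0r mulr0.
rewrite /aj eqxx mulrCA; congr (_ * _).
rewrite (bigD1 l) //= [RHS](bigD1 l) //= mulrA; congr (_ * _).
  by rewrite !ffunE eqxx signr_addb mulrC.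
by apply: eq_bigr => k /negPf kl; rewrite !ffunE kl addbF.
Qed.

(** This is Blei's inequality. The M + 1 numbers E to which the inequality of
    means is applied at s have product |a s|^(2M) and, summed over s, are each at
    most 1. *)
Lemma blei_sum a (p : R) : (0 < M)%N ->
  2 * M%:R / (M%:R + 1) <= p ->
  (forall l, \sum_t slice_norm a l t <= 1) ->
  \sum_s `|a s| `^ p <= 1.
Proof.
move=> M0 pge a1.
have n0 l t : 0 <= slice_norm a l t by rewrite sqrtr_ge0.
have an s l : `|a s| <= slice_norm a l (s l).
  rewrite -sqrtr_sqr ler_wsqrtr // (bigD1 s) //= lerDl.
  by apply: sumr_ge0 => u _; rewrite sqr_ge0.
have n1 l t : slice_norm a l t <= 1.
  apply: le_trans (a1 l); rewrite (bigD1 t) //= lerDl.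
  by apply: sumr_ge0 => u _.
have M1 : 0 < M%:R + 1 :> R by rewrite ltr_wpDl ?ler0n.
pose q : R := 2 * M%:R / (M%:R + 1).
have q0 : 0 < q by rewrite !mulr_gt0 ?ltr0n ?invr_gt0.
pose g (s : {ffun L -> T}) := (\prod_l slice_norm a l (s l) +
  \sum_l a s ^+ 2 / slice_norm a l (s l)) / (M%:R + 1).
have ag s : `|a s| `^ p <= g s.
  have g0 : 0 <= g s.
    rewrite mulr_ge0 ?invr_ge0 ?(ltW M1) // addr_ge0 ?prodr_ge0 //.
    by apply: sumr_ge0 => l _; rewrite mulr_ge0 ?sqr_ge0 ?invr_ge0.
  have [->|as0] := eqVneq (a s) 0.
    by rewrite normr0 powR0 // gt_eqF // (lt_le_trans q0).
  have as_gt0 : 0 < `|a s| by rewrite normr_gt0.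
  have [l0 _] : exists l0, l0 \in L by apply/card_gt0P.
  apply: (@le_trans _ _ (`|a s| `^ q)).
    by apply: ger_powR => //; rewrite as_gt0 (le_trans (an s l0)).
  (* the M + 1 nonnegative numbers have product |a s| ^ (2 M) *)
  pose E (i : unit + L) : R := match i with
    | inl _ => \prod_l slice_norm a l (s l)
    | inr l => a s ^+ 2 / slice_norm a l (s l) end.
  have n_gt0 l : 0 < slice_norm a l (s l) by apply: lt_le_trans (an s l).
  have [] := @leif_AGM R _ predT E.
    move=> [u|l] _ /=; first by apply: prodr_ge0.
    by rewrite divr_ge0 ?sqr_ge0.
  rewrite !big_sumType /= !(big_pred1 tt) /=; do ?by case.
  rewrite card_sum card_unit big_split /= prodfV mulrCA mulfV ?mulr1; last first.
    by apply/prodf_neq0 => l _; rewrite gt_eqF.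
  rewrite prodr_const -exprM -/(g s) natrD [1%:R + _]addrC => H _.
  have -> : q = (2 * M)%:R * (M.+1)%:R^-1 by rewrite natrM -[M.+1]addn1 natrD.
  rewrite powRrM powR_mulrn // exprM real_normK ?num_real // -exprM.
  have -> : g s = (g s ^+ M.+1) `^ (M.+1)%:R^-1.
    by rewrite -powR_mulrn // -powRrM mulfV ?powRr1 // pnatr_eq0.
  have a0 : 0 <= a s ^+ (2 * M) by rewrite exprM exprn_ge0 ?sqr_ge0.
  apply: ge0_ler_powR; last exact: H.
  - by rewrite invr_ge0 ler0n.
  - by rewrite nnegrE.
  - by rewrite nnegrE exprn_ge0.
apply: le_trans (ler_sum _ (fun s _ => ag s)) _.
rewrite -mulr_suml ler_pdivrMr // mul1r big_split /= addrC lerD //.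
  rewrite exchange_big /=.
  apply: (@le_trans _ _ (\sum_(l : L) 1)); last by rewrite sumr_const.
  apply: ler_sum => l _; apply: le_trans (a1 l).
  rewrite (partition_big (fun s : {ffun L -> T} => s l) xpredT) //=.
  apply: ler_sum => t _; rewrite (eq_bigr (fun s => a s ^+ 2 / slice_norm a l t)).
    rewrite -mulr_suml -[X in X / _]sqr_sqrtr; last first.
      by apply: sumr_ge0 => u _; rewrite sqr_ge0.
    rewrite -/(slice_norm a l t); have [->|nz] := eqVneq (slice_norm a l t) 0.
      by rewrite expr0n mul0r.
    by rewrite expr2 mulfK.
  by move=> s /eqP->.
rewrite -(bigA_distr_bigA (fun l t => slice_norm a l t)).
by apply: prodr_ile1 => l _; rewrite a1 sumr_ge0.
Qed.

Lemma bohnenblust_hille_array a (p B : R) : (0 < M)%N -> 0 < B ->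
  2 * M%:R / (M%:R + 1) <= p -> sign_bounded a B ->
  \sum_s `|a s| `^ p <= (khinchine_constant * B) `^ p.
Proof.
move=> M0 B0 pge aB.
have k0 : 0 < khinchine_constant.
  by rewrite mulr_gt0 // sqrtr_gt0 mulr_gt0 // exprn_gt0.
pose c := khinchine_constant * B; have c0 : 0 < c by rewrite mulr_gt0.
have sn l t : slice_norm (fun s => a s / c) l t = slice_norm a l t / c.
  rewrite /slice_norm (eq_bigr (fun s => a s ^+ 2 / c ^+ 2)).
    rewrite -mulr_suml sqrtrM ?sqrtrV ?sqr_ge0 //.
      by rewrite sqrtr_sqr ger0_norm // ltW.
    by apply: sumr_ge0 => s _; rewrite sqr_ge0.
  by move=> s _; rewrite exprMn exprVn.
have := @blei_sum (fun s => a s / c) p M0 pge.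
rewrite (eq_bigr (fun s => `|a s| `^ p / c `^ p)); last first.
  move=> s _; rewrite normrM normfV (gtr0_norm c0) powRM ?invr_ge0 // ?ltW //.
  congr (_ * _); apply: (mulfI (x := c `^ p)); rewrite ?gt_eqF ?powR_gt0 //.
  rewrite -powRM ?invr_ge0 ?(ltW c0) // !divff ?powR1 // gt_eqF ?powR_gt0 //.
rewrite -mulr_suml ler_pdivrMr ?powR_gt0 // mul1r; apply => l.
rewrite (eq_bigr (fun t => slice_norm a l t / c)) => [|t _]; last exact: sn.
by rewrite -mulr_suml ler_pdivrMr // mul1r slice_norm_sum_le.
Qed.

End Arrays.

(** * From separate to joint expansions *)

(** Evaluation points whose vectors of values (v s u)_s span all such vectors
    determine every function in the span of the v s; the interpolating functions
    are again in that span. The points are found by enlarging a matrix of values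
    until its rank is maximal. *)
Lemma span_interpolation (K : fieldType) (X : Type) (D : X -> Prop)
    (S : finType) (v : S -> X -> K) :
  exists r (u : 'I_r -> X) (c : 'I_r -> S -> K), (forall g, D (u g)) /\
  forall Q : X -> K,
    (exists q : S -> K, forall z, D z -> Q z = \sum_s q s * v s z) ->
    forall z, D z -> Q z = \sum_g (\sum_s c g s * v s z) * Q (u g).
Proof.
pose rv z : 'rV[K]_#|S| := \row_i v (enum_val i) z.
pose Mt r (u : 'I_r -> X) : 'M[K]_(r, #|S|) := \matrix_(g < r) rv (u g).
have [r [u [Du full]]] : exists r (u : 'I_r -> X), (forall g, D (u g)) /\
    forall z, D z -> (rv z <= Mt r u)%MS.
  suff: forall k r (u : 'I_r -> X), (forall g, D (u g)) ->
      (#|S| - \rank (Mt r u) <= k)%N -> exists r (u : 'I_r -> X),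
      (forall g, D (u g)) /\ forall z, D z -> (rv z <= Mt r u)%MS.
    move/(_ #|S| 0%N (fun i => False_rect _ (notF (valP i)))); apply.
      by case.
    exact: leq_subr.
  elim=> [|k IHk] r u Du rk.
    exists r, u; split=> // z _; apply: submx_full.
    by rewrite /row_full eqn_leq rank_leq_col -subn_eq0 -leqn0.
  have [full|/existsNP[z /not_implyP[Dz /negP nz]]] :=
    pselect (forall z, D z -> (rv z <= Mt r u)%MS); first by exists r, u.
  pose u' (g : 'I_(r + 1)) := match fintype.split g with inl g => u g | inr _ => z end.
  apply: (IHk _ u'); first by move=> g; rewrite /u'; case: (fintype.split g).
  have E : Mt _ u' = col_mx (Mt r u) (rv z).
    by apply/matrixP=> g j; rewrite !mxE /u'; case: (fintype.split g) => h; rewrite !mxE.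
  have : (Mt r u < Mt _ u')%MS.
    rewrite E ltmxE -!addsmxE addsmxSl /=; apply: contra nz.
    exact/submx_trans/addsmxSr.
  move/rank_ltmx; have := rank_leq_col (Mt r u).
  move: rk; lia.
exists r, u, (fun g s => pinvmx (Mt r u) (enum_rank s) g); split=> // Q [q qE] z Dz.
have := mulmxKpV (full z Dz); set w := rv z *m _ => wE.
have wg g : w 0 g = \sum_s pinvmx (Mt r u) (enum_rank s) g * v s z.
  rewrite mxE (reindex (@enum_rank S)) /=; last exact/onW_bij/enum_rank_bij.
  by apply: eq_bigr => s _; rewrite !mxE enum_rankK mulrC.
under eq_bigr do rewrite -wg qE // mulr_sumr.
rewrite qE // exchange_big /=; apply: eq_bigr => s _.
under eq_bigr do rewrite mulrCA; rewrite -mulr_sumr; congr (_ * _).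
move/rowP/(_ (enum_rank s)): wE; rewrite !mxE enum_rankK => <-.
by apply: eq_bigr => g _; rewrite !mxE enum_rankK.
Qed.

Section SeparateToJoint.
Variables (K : fieldType) (I L T : finType) (tau : L -> I) (E : Type).
Variables (D : E -> Prop) (xi : E -> T -> K).

Definition slot_monomial (i : I) (z : E) (s : {ffun L -> T}) : K :=
  \prod_(l | tau l == i) xi z (s l).

(** A function that is, in each variable separately, a combination of monomials
    of a given type is jointly such a combination. Variables are treated one
    after the other: interpolating in the variable i expresses F through values
    of F at fixed points of that variable, so that the coefficients obtained for
    the previous variables become free of the variable i, at the price of
    monomials in it. A word has a letter in every slot, also in those of other
    variables, which is why T is required to be inhabited. *)
Lemma separate_to_joint (t0 : T) (F : (I -> E) -> K) :
  (exists e, D e) ->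
  (forall i x, (forall k, D (x k)) -> exists q : {ffun L -> T} -> K,
     forall z, D z ->
       F (dfwith x i z) = \sum_s q s * slot_monomial i z s) ->
  exists b : {ffun L -> T} -> K, forall x, (forall k, D (x k)) ->
    F x = \sum_s b s * \prod_l xi (x (tau l)) (s l).
Proof.
move=> [e0 De0] sep.
suff H (r : seq I) : uniq r ->
    exists c : {ffun L -> T} -> (I -> E) -> K,
      (forall s x y, (forall i, i \notin r -> x i = y i) -> c s x = c s y) /\
      forall x, (forall k, D (x k)) ->
        F x = \sum_s c s x * \prod_(l | tau l \in r) xi (x (tau l)) (s l).
  have [c [cE FE]] := H (enum I) (enum_uniq _).
  exists (fun s => c s (fun=> e0)) => x Dx; rewrite FE //.
  apply: eq_bigr => s _; congr (_ * _); first by apply: cE => i; rewrite mem_enum.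
  by apply: eq_bigl => l; rewrite mem_enum.
elim: r => [_|i r IHr /= /andP[ir /IHr[c [cE FE]]]].
  (* no slot belongs to a treated variable: F is its own coefficient, at one word *)
  pose s0 : {ffun L -> T} := [ffun=> t0].
  exists (fun s x => if s == s0 then F x else 0); split=> [s x y xy|x Dx].
    by rewrite (_ : x = y) //; apply/funext => j; apply: xy.
  rewrite (bigD1 s0) //= eqxx big_pred0 ?mulr1 // big1 ?addr0 // => s.
  by move=> /negPf->; rewrite mul0r.
have [g [u [d [Du interp]]]] :=
  span_interpolation D (fun s z => slot_monomial i z s).
(* s carries the letters of the variables already treated, s' those of i *)
pose merge (s s' : {ffun L -> T}) : {ffun L -> T} :=
  [ffun l => if tau l == i then s' l else s l].
pose cc s s' x := \sum_h d h s' * c s (dfwith x i (u h)).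
exists (fun w x => \sum_(p | merge p.1 p.2 == w) cc p.1 p.2 x); split.
  move=> w x y xy; apply: eq_bigr => p _; apply: eq_bigr => h _.
  congr (_ * _); apply: cE => j jr.
  have [<-|ij] := eqVneq i j; first by rewrite !dfwithin.
  by rewrite !dfwithout //; apply: xy; rewrite inE negb_or eq_sym ij.
move=> x Dx.
have Dxu h k : D (dfwith x i (u h) k).
  by have [<-|ik] := eqVneq i k; rewrite ?dfwithin ?dfwithout.
have -> : F x = F (dfwith x i (x i)).
  by congr F; apply/funext => j; case: dfwithP.
rewrite (interp (fun z => F (dfwith x i z))) //; last exact: sep.
transitivity (\sum_p cc p.1 p.2 x *
    \prod_(l | tau l \in i :: r) xi (x (tau l)) (merge p.1 p.2 l)); last first.
  rewrite (partition_big (fun p => merge p.1 p.2) xpredT) //=.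
  by apply: eq_bigr => w _; rewrite mulr_suml; apply: eq_bigr => p /eqP->.
rewrite -(pair_bigA _ (fun s s' => cc s s' x *
    \prod_(l | tau l \in i :: r) xi (x (tau l)) (merge s s' l))) /=.
rewrite (eq_bigr (fun h => \sum_s \sum_s' (d h s' * c s (dfwith x i (u h))) *
    \prod_(l | tau l \in i :: r) xi (x (tau l)) (merge s s' l))); last first.
  move=> h _; rewrite FE // mulr_sumr; apply: eq_bigr => s _.
  rewrite mulr_suml; apply: eq_bigr => s' _.
  rewrite mulrACA; congr (_ * _).
  rewrite [RHS](bigID (fun l => tau l == i)) /=; congr (_ * _).
    apply: eq_big => [l|l /eqP li]; first by
      case: (eqVneq (tau l) i) => [->|_]; rewrite ?mem_head ?andbF.
    by rewrite ffunE li eqxx.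
  apply: eq_big => [l|l lr].
    rewrite inE; have [->|] := eqVneq (tau l) i; rewrite ?(negPf ir) //=.
    by rewrite andbT.
  have li : i != tau l by apply: contraNneq ir => ->.
  by rewrite dfwithout // ffunE eq_sym (negPf li).
rewrite exchange_big; apply: eq_bigr => s _.
by rewrite exchange_big; apply: eq_bigr => s' _ /=; rewrite mulr_suml.
Qed.

End SeparateToJoint.

(** * Expansion of a multihomogeneous polynomial along words *)

Section FiniteSupport.
Variable K : numFieldType.

Definition supported_below (J : nat) (x : c0 K) :=
  forall j, (J <= j)%N -> c0_val x j = 0.

Lemma truncation_null (J : nat) (f : nat -> K) :
  (fun j => if (j < J)%N then f j else 0 : K^o) \in @null_sequence K.
Proof.
apply/asboolP; apply: cvg_near_cst.
by exists J => // j /= Jj; rewrite ltnNge Jj.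
Qed.

Definition truncation (J : nat) (f : nat -> K) : c0 K := C0 (truncation_null J f).

Lemma truncation_supported J f : supported_below J (truncation J f).
Proof. by move=> j Jj; rewrite /= ltnNge Jj. Qed.

Lemma c0_valD (x y : c0 K) j : c0_val (x + y) j = c0_val x j + c0_val y j.
Proof. by []. Qed.

Lemma c0_valZ (a : K) (x : c0 K) j : c0_val (a *: x) j = a * c0_val x j.
Proof. by []. Qed.

Lemma c0_val_sum (I : Type) (r : seq I) (P : pred I) (f : I -> c0 K) j :
  c0_val (\sum_(i <- r | P i) f i) j = \sum_(i <- r | P i) c0_val (f i) j.
Proof. by elim/big_rec2: _ => // i y x _ <-. Qed.

Definition unit_vector (j : nat) : c0 K := truncation j.+1 (fun i => (i == j)%:R).

Lemma unit_vectorE j i : c0_val (unit_vector j) i = (i == j)%:R.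
Proof. by rewrite /= ltnS; have [->|ij] := eqVneq i j; rewrite ?leqnn ?if_same. Qed.

Lemma unit_vector_expansion J (z : c0 K) : supported_below J z ->
  z = \sum_(j < J) c0_val z j *: unit_vector j.
Proof.
move=> zJ; apply/val_inj/funext => i.
rewrite [RHS]c0_val_sum; have [iJ|Ji] := ltnP i J; last first.
  rewrite [LHS]zJ // big1 // => j _; rewrite c0_valZ unit_vectorE.
  by rewrite (gtn_eqF (leq_trans (ltn_ord j) Ji)) mulr0.
rewrite (bigD1 (Ordinal iJ)) // big1 => [|j ji].
  by rewrite [RHS]addr0 c0_valZ unit_vectorE eqxx mulr1.
rewrite c0_valZ unit_vectorE (_ : (i == j) = false) ?mulr0 //.
by apply: contraNF ji => /eqP ij; apply/eqP/val_inj.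
Qed.

Lemma linear_sum (E F : normedModType K) (f : E -> F) (I : Type) (r : seq I)
    (a : I -> K) (x : I -> E) : linear f ->
  f (\sum_(i <- r) a i *: x i) = \sum_(i <- r) a i *: f (x i).
Proof.
move=> lf; have f0 : f 0 = 0.
  by have := lf (-1) 0 0; rewrite scaler0 addr0 scaleN1r addNr.
by elim: r => [|i r IHr]; rewrite ?big_nil // !big_cons lf IHr.
Qed.

Lemma sum_fibers (G S : finType) (w : G -> S) (b : G -> K) (v : S -> K) :
  \sum_g b g * v (w g) = \sum_s (\sum_(g | w g == s) b g) * v s.
Proof.
rewrite (partition_big w xpredT) //=; apply: eq_bigr => s _.
by rewrite mulr_suml; apply: eq_bigr => g /eqP->.
Qed.

Lemma multilinear_expansion n J (A : ('I_n -> c0 K) -> K^o) : multilinear A ->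
  exists b : {ffun 'I_n -> 'I_J.+1} -> K,
    forall x, (forall l, supported_below J.+1 (x l)) ->
    A x = \sum_s b s * \prod_l c0_val (x l) (s l).
Proof.
move=> linA.
pose coordinate (z : c0 K) (j : 'I_J.+1) : K := c0_val z j.
apply: (@separate_to_joint K _ _ 'I_J.+1 id _ (supported_below J.+1)
  coordinate ord0 A); first by exists 0.
move=> i x Dx.
(* the letter j in slot i is represented by the word that repeats j *)
exists (fun s => \sum_(j | [ffun=> j] == s) A (dfwith x i (unit_vector (j : 'I_J.+1)))).
move=> z Dz.
rewrite -(sum_fibers (fun j : 'I_J.+1 => [ffun=> j] : {ffun 'I_n -> 'I_J.+1})
  (fun j => A (dfwith x i (unit_vector j)))
  (fun s => slot_monomial id coordinate i z s)).
rewrite [in LHS](unit_vector_expansion Dz) (linear_sum _ _ _ (linA i x)).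
apply: eq_bigr => j _.
by rewrite /slot_monomial big_pred1_eq ffunE [RHS]mulrC.
Qed.

Lemma prod_slots m (n : 'I_m -> nat) i (F : {i : 'I_m & 'I_(n i)} -> K) :
  \prod_(l | tag l == i) F l = \prod_(k < n i) F (Tagged (fun i => 'I_(n i)) k).
Proof.
transitivity (\prod_(i' | i' == i) \prod_(k < n i') F (Tagged (fun i => 'I_(n i)) k)).
  rewrite (@sig_big_dep _ _ *%R _ _ (pred1 i) (fun _ => xpredT)
    (fun i' (k : 'I_(n i')) => F (Tagged (fun i => 'I_(n i)) k))) /=.
  by apply: eq_big => [l|[]] //=; rewrite ?andbT.
by rewrite big_pred1_eq.
Qed.

(** Each partial map is a multilinear map on a diagonal, hence a combination of
    words on the slots of its variable. *)
Lemma multihomogeneous_expansion m (n : 'I_m -> nat) J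
    (P : ('I_m -> c0 K) -> K^o) : multihomogeneous_polynomial n P ->
  exists b : {ffun {i : 'I_m & 'I_(n i)} -> 'I_J.+1} -> K,
    forall x, (forall l, supported_below J.+1 (x l)) ->
    P x = \sum_s b s * \prod_l c0_val (x (tag l)) (s l).
Proof.
move=> homP.
pose coordinate (z : c0 K) (j : 'I_J.+1) : K := c0_val z j.
apply: (@separate_to_joint K _ _ 'I_J.+1 tag _ (supported_below J.+1)
  coordinate ord0 P); first by exists 0.
move=> i x Dx.
have [A linA PA] := homP i x.
have [b bE] := multilinear_expansion J linA.
pose ext (s : {ffun 'I_(n i) -> 'I_J.+1}) : {ffun {i : 'I_m & 'I_(n i)} -> 'I_J.+1} :=
  [ffun l => untag ord0 s l].
exists (fun w => \sum_(s | ext s == w) b s) => z Dz.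
rewrite -(sum_fibers ext b
  (fun s => slot_monomial tag coordinate i z s)).
rewrite PA bE; last by move=> _; exact: Dz.
apply: eq_bigr => s _; congr (_ * _).
rewrite /slot_monomial prod_slots; apply: eq_bigr => k _.
by rewrite ffunE (untagE _ _ (erefl : tag (Tagged (fun i => 'I_(n i)) k) = i)).
Qed.

End FiniteSupport.

(** * Polarization of a combination of words *)

Section Polarization.
Variables (K : numFieldType) (I L T : finType) (tau : L -> I).

Definition word_form (b : {ffun L -> T} -> K) (x : I -> T -> K) : K :=
  \sum_s b s * \prod_l x (tau l) (s l).

Definition signed_sum (y : L -> T -> K) (e : {ffun L -> bool}) (i : I) (t : T) :=
  \sum_(l | tau l == i) (-1) ^+ e l * y l t.

Definition polarization (F : (I -> T -> K) -> K) (y : L -> T -> K) : K :=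
  \sum_(e : {ffun L -> bool}) (\prod_l (-1) ^+ e l) * F (signed_sum y e).

Definition delta_vectors (s : L -> T) (l : L) (t : T) : K := (t == s l)%:R.

Definition slot_symmetries : {pred {perm L}} :=
  [pred g : {perm L} | [forall l, tau (g l) == tau l]].

(** If f misses the slot k, flipping the sign at k changes the sign of the whole
    sum. *)
Lemma sum_sign_words (f : {ffun L -> L}) :
  \sum_(e : {ffun L -> bool}) (\prod_l (-1) ^+ e l) * (\prod_l (-1) ^+ e (f l))
  = (if injectiveb f then 2 ^+ #|L| else 0 : K).
Proof.
case: injectiveP => [injf|ninjf].
  transitivity (\sum_(e : {ffun L -> bool}) (1 : K)); last first.
    by rewrite sumr_const card_ffun card_bool natrX.
  apply: eq_bigr => e _; rewrite [X in X * _](reindex_inj injf) /=.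
  by rewrite -big_split big1 //= => l _; rewrite -signr_addb addbb.
have [k kf] : exists k, k \notin codom f.
  apply/existsP; rewrite -negb_forall; apply: contra_notN ninjf => /forallP fk.
  apply/injectiveP; rewrite /injectiveb /dinjectiveb.
  apply: (leq_size_uniq (enum_uniq L)) => [k _|]; first exact: fk.
  by rewrite size_map leqnn.
set S := \sum_e _; suff : S = - S.
  by move/eqP; rewrite -addr_eq0 -mulr2n mulrn_eq0 /= => /eqP.
pose flip (e : {ffun L -> bool}) : {ffun L -> bool} :=
  [ffun l => e l (+) (l == k)].
have flipI : injective flip.
  apply: (can_inj (g := flip)) => e; apply/ffunP=> l.
  by rewrite !ffunE -addbA addbb addbF.
rewrite {1}/S (reindex_inj flipI) -sumrN; apply: eq_bigr => e _.
rewrite -mulNr; congr (_ * _); last first.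
  apply: eq_bigr => l _; rewrite ffunE (_ : (f l == k) = false) ?addbF //.
  by apply: contraNF kf => /eqP <-; apply: codom_f.
rewrite (bigD1 k) //= [in RHS](bigD1 k) //= -mulNr ffunE eqxx addbT signrN.
by congr (_ * _); apply: eq_bigr => l /negPf lk; rewrite ffunE lk addbF.
Qed.

Lemma sum_injective_ffun (P : pred {ffun L -> L}) (G : {ffun L -> L} -> K) :
  \sum_(f | P f && injectiveb f) G f = \sum_(g : {perm L} | P (pval g)) G (pval g).
Proof.
rewrite (reindex (@pval L)) /=.
  by apply: eq_bigl => g; rewrite (valP g) andbT.
pose toperm := insubd (1%g : {perm L}).
exists toperm => /= f; first by move=> _; apply: val_inj; apply/insubdK/(valP f).
by case/andP=> _ fi; apply: insubdK.
Qed.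

(** Expanding the product over the slots of the signed sums gives a sum over all
    maps f from slots to slots of the same variable; the sum over the signs
    leaves only the bijective ones. *)
Lemma polarization_word_form b y : polarization (word_form b) y =
  2 ^+ #|L| * \sum_(g | g \in slot_symmetries) \sum_u b u * \prod_l y (g l) (u l).
Proof.
rewrite /polarization /word_form.
under eq_bigr do rewrite mulr_sumr.
rewrite exchange_big [X in _ * X]exchange_big mulr_sumr /=.
apply: eq_bigr => u _.
transitivity (\sum_(f in family (fun l => [pred k | tau k == tau l]))
   \sum_(e : {ffun L -> bool}) b u * (\prod_l y (f l) (u l)) *
     ((\prod_l (-1) ^+ e l) * (\prod_l (-1) ^+ e (f l)))).
  rewrite exchange_big; apply: eq_bigr => e _ /=.
  rewrite /signed_sum (bigA_distr_big_dep (fun l k => tau k == tau l)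
    (fun l k => (-1) ^+ e k * y k (u l))) mulr_sumr mulr_sumr.
  by apply: eq_bigr => f _; rewrite big_split /=; ring.
rewrite (eq_bigr (fun f : {ffun L -> L} => b u * (\prod_l y (f l) (u l)) *
    (if injectiveb f then 2 ^+ #|L| else 0))) => [|f _]; last first.
  by rewrite -mulr_sumr sum_sign_words.
transitivity (\sum_(f : {ffun L -> L} | [forall l, tau (f l) == tau l] && injectiveb f)
   b u * (\prod_l y (f l) (u l)) * 2 ^+ #|L|).
  rewrite big_mkcondr /=; apply: eq_big => [f|f _].
    by apply/familyP/forallP => fP l; have := fP l.
  by case: ifP => //; rewrite mulr0.
rewrite (sum_injective_ffun (fun f => [forall l, tau (f l) == tau l])) mulr_sumr.
apply: eq_big => [g|g _].
  by rewrite inE; apply: eq_forallb => l; rewrite -pvalE.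
by rewrite mulrC; congr (_ * (_ * _)); apply: eq_bigr => l _; rewrite -pvalE.
Qed.

Definition permute_word (g : {perm L}) (s : {ffun L -> T}) : {ffun L -> T} :=
  [ffun l => s (g l)].

Lemma permute_word_inj g : injective (permute_word g).
Proof.
move=> s s' /ffunP ss; apply/ffunP=> l.
by have := ss (g^-1%g l); rewrite !ffunE permKV.
Qed.

Lemma polarization_delta b (s : {ffun L -> T}) :
  polarization (word_form b) (delta_vectors s) =
  2 ^+ #|L| * \sum_(g | g \in slot_symmetries) b (permute_word g s).
Proof.
rewrite polarization_word_form; congr (_ * _); apply: eq_bigr => g _.
rewrite (bigD1 (permute_word g s)) //= [X in _ + X]big1 ?addr0 => [|u].
  by rewrite big1 ?mulr1 // => l _; rewrite /delta_vectors ffunE eqxx.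
move=> us; have /existsP[l ul] : [exists l, u l != s (g l)].
  rewrite -negb_forall; apply: contraNN us => /forallP us.
  by apply/eqP/ffunP=> l; rewrite ffunE; apply/eqP.
by rewrite (bigD1 l) //= /delta_vectors (negPf ul) mul0r mulr0.
Qed.

Lemma polarization_multilinear b y : polarization (word_form b) y =
  \sum_(s : {ffun L -> T}) polarization (word_form b) (delta_vectors s) * \prod_l y l (s l).
Proof.
under [RHS]eq_bigr do rewrite polarization_delta -mulrA mulr_suml.
rewrite -mulr_sumr polarization_word_form; congr (_ * _).
rewrite [RHS]exchange_big /=; apply: eq_bigr => g _.
rewrite (reindex_inj (@permute_word_inj g)); apply: eq_bigr => s _.
congr (_ * _); rewrite [RHS](reindex_inj (@perm_inj _ g)) /=.
by apply: eq_bigr => l _; rewrite ffunE.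
Qed.

End Polarization.

(** * Words and multi-indices *)

Definition letter_counts (r : seq nat) : multiindex :=
  [fsfun j in seq_fset tt r => count_mem j r].

Lemma letter_countsE r j : letter_counts r j = count_mem j r.
Proof.
rewrite fsfunE seq_fsetE; case: ifPn => //.
by rewrite -has_pred1 has_count -eqn0Ngt => /eqP.
Qed.

(** A multi-index is the vector of multiplicities of the letters of a word; this
    picks one such word, with equal letters grouped together. *)
Definition letters (a : multiindex) : seq nat :=
  flatten [seq nseq (a j) j | j <- finsupp a].

Lemma count_letters a j : count_mem j (letters a) = a j.
Proof.
rewrite /letters count_flatten -map_comp sumnE big_map.
under eq_bigr do rewrite /= count_nseq /=.
have [ja|ja] := boolP (j \in finsupp a); last first.
  rewrite big1_seq ?fsfun_dflt // => i /andP[_ ia].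
  by case: eqP => [ij|]; rewrite ?mul0n // -ij ia in ja.
rewrite (big_fsetD1 j) //= eqxx mul1n big1_seq ?addn0 // => i.
by rewrite !inE => /andP[_ /andP[/negPf-> _]].
Qed.

Lemma lettersK : cancel letters letter_counts.
Proof.
by move=> a; apply/fsfunP => j; rewrite letter_countsE count_letters.
Qed.

Lemma perm_letters r : perm_eq (letters (letter_counts r)) r.
Proof.
by apply/allP => j _ /=; rewrite count_letters letter_countsE.
Qed.

Lemma size_letters a : size (letters a) = multiindex_deg a.
Proof.
rewrite size_flatten /shape -map_comp sumnE big_map.
by apply: eq_bigr => j _; rewrite /= size_nseq.
Qed.

Lemma monomialE (K : numFieldType) (x : nat -> K) a :
  monomial x a = \prod_(j <- letters a) x j.
Proof.
rewrite /letters big_flatten big_map; apply: eq_bigr => j _.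
by rewrite big_nseq iter_mulr_1.
Qed.

Section Words.
Variables (m : nat) (n : 'I_m -> nat).

Definition slot := {i : 'I_m & 'I_(n i)}.

Lemma card_slot : #|{: slot}| = (\sum_(j < m) n j)%N.
Proof. by rewrite card_tagged sumnE big_map big_enum; apply: eq_bigr => i _; rewrite card_ord. Qed.

Definition word_index (u : slot -> nat) : 'I_m -> multiindex :=
  fun i => letter_counts [seq u (Tagged (fun i => 'I_(n i)) k) | k <- enum 'I_(n i)].

Lemma word_index_multidegree u : multidegree n (word_index u).
Proof.
move=> i; rewrite -size_letters (perm_size (perm_letters _)).
by rewrite size_map -cardE card_ord.
Qed.

Lemma word_indexE u i j :
  word_index u i j = (\sum_(l | tag l == i) (u l == j))%N.
Proof.
rewrite letter_countsE -sum1_count big_map big_mkcond /=.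
rewrite big_enum /=.
transitivity (\sum_(i' | i' == i) \sum_(k < n i')
    (u (Tagged (fun i => 'I_(n i)) k) == j : nat))%N.
  by rewrite big_pred1_eq; apply: eq_bigr => k _; case: eqP.
rewrite (@sig_big_dep _ _ addn _ _ (pred1 i) (fun _ => xpredT)
    (fun i' (k : 'I_(n i')) => (u (Tagged (fun i => 'I_(n i)) k) == j : nat))) /=.
by apply: eq_big => [l|[]] //=; rewrite ?andbT.
Qed.

Lemma word_index_permute u (g : {perm slot}) :
  (forall l, tag (g l) = tag l) -> word_index (u \o g) = word_index u.
Proof.
move=> gt; apply/funext => i; apply/fsfunP => j; rewrite !word_indexE.
rewrite [RHS](reindex_inj (@perm_inj _ g)) /=.
by apply: eq_bigl => l; rewrite gt.
Qed.

Lemma prod_monomial_word_index (K : numFieldType) (x : 'I_m -> nat -> K) u :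
  \prod_i monomial (x i) (word_index u i) = \prod_l x (tag l) (u l).
Proof.
transitivity (\prod_i \prod_(k < n i) x i (u (Tagged (fun i => 'I_(n i)) k))).
  apply: eq_bigr => i _; rewrite monomialE (perm_big _ (perm_letters _)) /=.
  by rewrite big_map big_enum.
rewrite (@sig_big_dep _ _ *%R _ _ xpredT (fun _ => xpredT)
    (fun i (k : 'I_(n i)) => x i (u (Tagged (fun i => 'I_(n i)) k)))) /=.
by apply: eq_bigr => -[].
Qed.

(** The default value 0 of nth is not reached when a has multidegree n. *)
Definition canonical_word (a : 'I_m -> multiindex) : slot -> nat :=
  fun l => nth 0%N (letters (a (tag l))) (tagged l).

Lemma canonical_wordK a : multidegree n a -> word_index (canonical_word a) = a.
Proof.
move=> an; apply/funext => i; rewrite /word_index -[RHS]lettersK.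
congr letter_counts; have sz : size (letters (a i)) = n i.
  by rewrite size_letters an.
apply: (@eq_from_nth _ 0%N) => [|k]; first by rewrite size_map -cardE card_ord.
rewrite size_map -cardE card_ord => kn.
rewrite (nth_map (Ordinal kn)) -?cardE ?card_ord // /canonical_word /=.
by rewrite nth_enum_ord.
Qed.

End Words.

(** * Coefficients as polarized values *)

Section CoefficientsFromValues.
Variables (K : numFieldType) (m : nat) (n : 'I_m -> nat).
Local Notation L := (slot n).
Local Notation tg := (@tag 'I_m (fun i => 'I_(n i))).
Implicit Types (P : ('I_m -> c0 K) -> K) (c : ('I_m -> multiindex) -> K).

Definition is_canonical_word (u : L -> nat) : bool :=
  [forall l, canonical_word (n := n) (word_index u) l == u l].

Lemma canonical_wordP u :
  reflect (canonical_word (n := n) (word_index u) = u) (is_canonical_word u).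
Proof.
apply: (iffP forallP) => [h|-> l //].
by apply/funext => l; apply/eqP.
Qed.

(** The factor by which polarization multiplies a coefficient, up to the power
    of 2 that comes from the signs. *)
Definition canonical_symmetries (u : L -> nat) : nat :=
  #|[pred g | (g \in slot_symmetries tg) && is_canonical_word (u \o g)]|.

Lemma canonical_symmetries_gt0 u : is_canonical_word u -> (0 < canonical_symmetries u)%N.
Proof.
move=> su; apply/card_gt0P; exists 1%g; rewrite inE /=.
rewrite (_ : u \o _ = u) ?su ?andbT; last by apply/funext => l /=; rewrite perm1.
by rewrite inE; apply/forallP => l; rewrite perm1.
Qed.

Section Truncated.
Variable J : nat.
Local Notation T := 'I_J.+1.
Implicit Types u s : {ffun L -> T}.

Definition nat_word u : L -> nat := fun l => u l.

Lemma nat_word_inj : injective nat_word.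
Proof.
move=> u v uv; apply/ffunP => l; apply: val_inj.
exact: (congr1 (fun f => f l) uv).
Qed.

Definition coordinates (x : 'I_m -> c0 K) : 'I_m -> T -> K :=
  fun i j => c0_val (x i) j.

Definition canonical_coefficients c u : K :=
  if is_canonical_word (nat_word u) then c (word_index (nat_word u)) else 0.

Lemma bounded_word (w : L -> nat) : (forall l, (w l < J.+1)%N) ->
  exists u, nat_word u = w.
Proof.
move=> wJ; exists [ffun l => Ordinal (wJ l)].
by apply/funext => l; rewrite /nat_word ffunE.
Qed.

(** The sum over all multi-indices is finite at arguments supported below J + 1,
    and the multi-indices that contribute correspond to the canonical words with
    letters at most J. *)
Lemma monomial_sum_canonical c (x : 'I_m -> c0 K) :
  (forall i, supported_below J.+1 (x i)) ->
  \sum_(a \in multidegree n) c a * \prod_i monomial (c0_val (x i)) (a i) =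
  word_form tg (canonical_coefficients c) (coordinates x).
Proof.
move=> xJ.
pose X (a : 'I_m -> multiindex) := \prod_i monomial (c0_val (x i)) (a i) : K.
have XE u : X (word_index (nat_word u)) = \prod_l coordinates x (tag l) (u l).
  exact: prod_monomial_word_index.
pose r := [seq word_index (nat_word u) |
  u <- enum [pred u | is_canonical_word (nat_word u)]].
rewrite (@fsbigE _ _ _ _ _ r).
- rewrite /r big_map (eq_bigl xpredT) => [|u]; last first.
    exact/mem_set/word_index_multidegree.
  rewrite big_enum /= /word_form big_mkcond /=.
  apply: eq_bigr => u _; rewrite /canonical_coefficients inE.
  by case: ifP => _; rewrite ?mul0r // -XE.
- rewrite map_inj_in_uniq ?enum_uniq // => u v.
  rewrite !mem_enum !inE => /canonical_wordP su /canonical_wordP sv uv.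
  by apply: nat_word_inj; rewrite -su uv sv.
- by move=> a /mapP[u _ ->]; apply: word_index_multidegree.
move=> a an ar; rewrite -/(X a).
have [aJ|/forallPn[l]] := boolP [forall l, (canonical_word (n := n) a l < J.+1)%N].
  have [u uE] := bounded_word (forallP aJ).
  case/negP: ar; apply/mapP; exists u; last by rewrite uE canonical_wordK.
  by rewrite mem_enum inE; apply/canonical_wordP; rewrite uE canonical_wordK.
rewrite -leqNgt => Jl; rewrite -(canonical_wordK an) /X prod_monomial_word_index.
by rewrite (bigD1 l) //= xJ // mul0r mulr0.
Qed.

Lemma polarization_canonical c s :
  polarization tg (word_form tg (canonical_coefficients c))
    (delta_vectors K s) =
  (2 ^ #|{: L}| * canonical_symmetries (nat_word s))%:R *
    c (word_index (nat_word s)).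
Proof.
rewrite polarization_delta natrM natrX -mulrA; congr (_ * _).
rewrite /canonical_symmetries -sum1_card natr_sum mulr_suml.
rewrite big_mkcondr /= [RHS]big_mkcond [LHS]big_mkcond /=.
apply: eq_bigr => g _; rewrite inE; case: ifP => //= gt.
rewrite /canonical_coefficients.
rewrite (_ : nat_word _ = nat_word s \o g); last first.
  by apply/funext => l; rewrite /nat_word /= ffunE.
rewrite word_index_permute => [|l]; last by apply/eqP/(forallP gt).
by case: ifP => _; rewrite ?mul1r.
Qed.

(** Words with the same index give the same monomial. *)
Lemma word_form_canonical (b : {ffun L -> T} -> K) (x : 'I_m -> c0 K) :
  word_form tg b (coordinates x) =
  word_form tg (canonical_coefficients (fun a =>
    \sum_(u | [forall i, word_index (nat_word u) i == a i]) b u)) (coordinates x).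
Proof.
pose X (a : 'I_m -> multiindex) := \prod_i monomial (c0_val (x i)) (a i) : K.
have XE u : \prod_l coordinates x (tag l) (u l) = X (word_index (nat_word u)).
  by rewrite /X prod_monomial_word_index.
rewrite /word_form.
rewrite [RHS](eq_bigr (fun v => \sum_u
    if is_canonical_word (nat_word v) && [forall i, word_index (nat_word u) i ==
      word_index (nat_word v) i] then b u * X (word_index (nat_word u)) else 0));
  last first.
  move=> v _; rewrite XE /canonical_coefficients; case: ifP => /= _; last first.
    by rewrite mul0r big1.
  rewrite mulr_suml -big_mkcond /=; apply: eq_bigr => u /forallP uv.
  by congr (_ * X _); apply/funext => i; rewrite (eqP (uv i)).
rewrite exchange_big; apply: eq_bigr => u _ /=.
have an := word_index_multidegree (nat_word u).
have aJ l : (canonical_word (n := n) (word_index (nat_word u)) l < J.+1)%N.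
  rewrite /canonical_word.
  have : nth 0%N (letters (word_index (nat_word u) (tag l))) (tagged l)
      \in letters (word_index (nat_word u) (tag l)).
    by rewrite mem_nth // size_letters an.
  rewrite (perm_mem (perm_letters _)) => /mapP[k _ ->].
  exact: ltn_ord.
have [v vE] := bounded_word aJ.
have sv : is_canonical_word (nat_word v) by apply/canonical_wordP; rewrite vE canonical_wordK.
rewrite (bigD1 v) //= [X in _ + X]big1 => [|w wv].
  rewrite sv addr0 ifT ?XE //.
  by apply/forallP => i; rewrite vE canonical_wordK.
case: ifP => // /andP[/canonical_wordP sw /forallP uw]; case/eqP: wv.
apply: nat_word_inj; rewrite -sw vE; congr canonical_word; apply/funext => i.
by rewrite (eqP (uw i)).
Qed.

End Truncated.

(** Polarization with vectors of c0 instead of finitely many coordinates, so that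
    it does not depend on a bound for the supports. *)
Definition polarized_value P (y : L -> c0 K) : K :=
  \sum_(e : {ffun L -> bool}) (\prod_l (-1) ^+ e l) *
    P (fun i => \sum_(l | tag l == i) (-1) ^+ e l *: y l).

Lemma polarized_valueE J P b (y : L -> c0 K) :
  (forall x, (forall i, supported_below J.+1 (x i)) ->
     P x = word_form tg b (@coordinates J x)) ->
  (forall l, supported_below J.+1 (y l)) ->
  polarized_value P y =
  polarization tg (word_form tg b)
    (fun l (j : 'I_J.+1) => c0_val (y l) j).
Proof.
move=> PE yJ; apply: eq_bigr => e _; congr (_ * _); rewrite PE.
  apply: eq_bigr => s _; congr (_ * _); apply: eq_bigr => l _.
  by rewrite [LHS]c0_val_sum; apply: eq_bigr.
move=> i j Jj; rewrite c0_val_sum big1 // => l _.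
by rewrite c0_valZ yJ ?mulr0.
Qed.

Lemma unit_vector_supported J (s : {ffun L -> 'I_J.+1}) l :
  supported_below J.+1 (unit_vector K (nat_word s l)).
Proof.
move=> j Jj; rewrite unit_vectorE gtn_eqF //.
by rewrite (leq_trans _ Jj) // ltn_ord.
Qed.

Lemma polarized_value_unit J P b (s : {ffun L -> 'I_J.+1}) :
  (forall x, (forall i, supported_below J.+1 (x i)) ->
     P x = word_form tg b (@coordinates J x)) ->
  polarized_value P (fun l => unit_vector K (nat_word s l)) =
  polarization tg (word_form tg b) (delta_vectors K s).
Proof.
move=> PE; rewrite (polarized_valueE PE (unit_vector_supported s)).
congr polarization; apply/funext => l; apply/funext => j.
by rewrite unit_vectorE.
Qed.

Lemma finite_supported_below (x : 'I_m -> c0 K) :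
  (forall i, finite_set [set j | c0_val (x i) j != 0]) ->
  exists J, forall i, supported_below J.+1 (x i).
Proof.
move=> xfin.
have /choice[N NE] i : exists N, supported_below N (x i).
  have /finite_setP[k /card_esym /card_set_bijP[f fb]] := xfin i.
  exists (\max_(j < k) (f j).+1)%N => j Nj; apply/eqP/contraT => xj.
  have [l lk fl] := set_bij_surj fb xj.
  move: Nj; rewrite leqNgt -fl => /negP[].
  exact: (leq_bigmax (F := fun j : 'I_k => (f j).+1) (Ordinal lk)).
exists (\max_i N i)%N => i j Jj; apply: NE; apply: leq_trans (ltnW Jj).
exact: leq_bigmax.
Qed.

(** For each bound J on the supports a word expansion exists, but its
    coefficients might depend on J. Polarization recovers them from values of P
    alone, by a formula that does not involve J. *)
Theorem monomial_expansion_exists P :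
  multihomogeneous_polynomial n
    (P : (forall i : 'I_m, c0 K) -> K^o) ->
  monomial_expansion n P (fun a =>
    polarized_value P (fun l => unit_vector K (canonical_word a l)) /
    (2 ^ #|{: L}| * canonical_symmetries (canonical_word a))%:R).
Proof.
move=> homP x /finite_supported_below[J xJ].
have [b bE] := multihomogeneous_expansion J homP.
rewrite (monomial_sum_canonical _ xJ) bE // -/(word_form tg b (coordinates x)).
rewrite word_form_canonical; apply: eq_bigr => u _; congr (_ * _).
rewrite /canonical_coefficients; case: ifPn => // su.
have /canonical_wordP -> := su.
have PE y : (forall i, supported_below J.+1 (y i)) ->
    P y = word_form tg (canonical_coefficients (fun a =>
    \sum_(u : {ffun L -> 'I_J.+1} | [forall i, word_index (nat_word u) i == a i])
      b u)) (@coordinates J y).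
  by move=> yJ; rewrite -word_form_canonical; apply: bE.
rewrite (polarized_value_unit _ PE) polarization_canonical // mulrAC mulfV ?mul1r //.
by rewrite pnatr_eq0 -lt0n muln_gt0 expn_gt0 canonical_symmetries_gt0.
Qed.

Lemma coefficient_expansion P :
  multihomogeneous_polynomial n (P : (forall i : 'I_m, c0 K) -> K^o) ->
  monomial_expansion n P (coefficient n P).
Proof.
move=> homP; have := @xgetPex _ (fun=> 0) [set c | monomial_expansion n P c].
by apply; eexists; apply: monomial_expansion_exists.
Qed.

(** As the factor is positive at canonical words, the coefficients are determined
    by P. *)
Lemma coefficient_polarized P J (s : {ffun L -> 'I_J.+1}) :
  multihomogeneous_polynomial n (P : (forall i : 'I_m, c0 K) -> K^o) ->
  (2 ^ #|{: L}| * canonical_symmetries (nat_word s))%:R *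
    coefficient n P (word_index (nat_word s)) =
  polarized_value P (fun l => unit_vector K (nat_word s l)).
Proof.
move=> homP; rewrite (polarized_value_unit (J := J)
   (b := canonical_coefficients (coefficient n P))).
  by rewrite polarization_canonical.
move=> x xJ; rewrite -monomial_sum_canonical //; apply: coefficient_expansion => // i.
apply: (sub_finite_set (B := `I_J.+1)); last exact: finite_II.
by move=> j /= xj; rewrite ltnNge; apply: contraNN xj => /xJ ->.
Qed.

End CoefficientsFromValues.

(** * Real and complex scalars *)

Section Scalars.
Variables (R : realType) (k : scalar_kind).
Local Notation K := (scalars R k).
Implicit Types x y : K.

Definition re_part : K -> R :=
  match k return scalars R k -> R with
  | RealScalars => fun x : R => x
  | ComplexScalars => @complex.Re R
  end.

Definition im_part : K -> R :=
  match k return scalars R k -> R with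
  | RealScalars => fun=> 0
  | ComplexScalars => @complex.Im R
  end.

Lemma re_partD x y : re_part (x + y) = re_part x + re_part y.
Proof. by rewrite /re_part; case: k x y => [//|[a b] [c d]]. Qed.

Lemma im_partD x y : im_part (x + y) = im_part x + im_part y.
Proof. by rewrite /im_part; case: k x y => [x y|[a b] [c d]] //; rewrite addr0. Qed.

Lemma re_part0 : re_part 0 = 0.
Proof. by rewrite /re_part; case: k. Qed.

Lemma im_part0 : im_part 0 = 0.
Proof. by rewrite /im_part; case: k. Qed.

Lemma re_part_sign (b : bool) x : re_part ((-1) ^+ b * x) = (-1) ^+ b * re_part x.
Proof.
rewrite !mulr_sign; case: b => //.
by rewrite /re_part; case: k x => [//|[a b]].
Qed.

Lemma im_part_sign (b : bool) x : im_part ((-1) ^+ b * x) = (-1) ^+ b * im_part x.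
Proof.
rewrite !mulr_sign; case: b => //.
by rewrite /im_part; case: k x => [|[a b]] //; rewrite oppr0.
Qed.

Lemma re_part_sum (I : Type) (r : seq I) (P : pred I) (F : I -> K) :
  re_part (\sum_(i <- r | P i) F i) = \sum_(i <- r | P i) re_part (F i).
Proof. exact: (big_morph _ re_partD re_part0). Qed.

Lemma im_part_sum (I : Type) (r : seq I) (P : pred I) (F : I -> K) :
  im_part (\sum_(i <- r | P i) F i) = \sum_(i <- r | P i) im_part (F i).
Proof. exact: (big_morph _ im_partD im_part0). Qed.

Lemma modulus_ge0 x : 0 <= modulus x.
Proof. by rewrite /modulus; case: k x => [x|[a b]] //=; rewrite sqrtr_ge0. Qed.

Lemma sqr_modulus x : modulus x ^+ 2 = re_part x ^+ 2 + im_part x ^+ 2.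
Proof.
rewrite /modulus /re_part /im_part; case: k x => [x|[a b]] /=.
  by rewrite real_normK ?num_real // expr0n addr0.
by rewrite sqr_sqrtr // addr_ge0 ?sqr_ge0.
Qed.

Lemma re_part_le x : `|re_part x| <= modulus x.
Proof.
rewrite -(ger0_norm (modulus_ge0 x)) -ler_sqr ?nnegrE // !real_normK ?num_real //.
by rewrite sqr_modulus lerDl sqr_ge0.
Qed.

Lemma im_part_le x : `|im_part x| <= modulus x.
Proof.
rewrite -(ger0_norm (modulus_ge0 x)) -ler_sqr ?nnegrE // !real_normK ?num_real //.
by rewrite sqr_modulus lerDr sqr_ge0.
Qed.

Lemma modulus_le_parts x : modulus x <= `|re_part x| + `|im_part x|.
Proof.
rewrite -ler_sqr ?nnegrE ?modulus_ge0 ?addr_ge0 // sqr_modulus sqrrD.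
by rewrite !real_normK ?num_real // -addrA lerD2l lerDr mulrn_wge0 ?mulr_ge0.
Qed.

Lemma normr_modulus x y : (`|x| <= `|y|) = (modulus x <= modulus y).
Proof.
case: k x y => [x y|x y]; first by [].
by rewrite -(modulusE x) -(modulusE y) lecR.
Qed.

Lemma modulusM x y : modulus (x * y) = modulus x * modulus y.
Proof. by rewrite /modulus; case: k x y => [x y|x y]; [exact: normrM|exact: Normc.normcM]. Qed.

Lemma modulusD x y : modulus (x + y) <= modulus x + modulus y.
Proof.
by rewrite /modulus; case: k x y => [x y|x y]; [exact: ler_normD|exact: le_normcD].
Qed.

Lemma modulus0 : modulus (0 : K) = 0.
Proof. by apply/eqP; rewrite -sqrf_eq0 sqr_modulus re_part0 im_part0 expr0n addr0. Qed.

Lemma modulus1 : modulus (1 : K) = 1.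
Proof. by rewrite /modulus; case: k; [exact: normr1|exact: Normc.normc1]. Qed.

Lemma modulus_nat n : modulus (n%:R : K) = n%:R.
Proof.
case: k; first exact: normr_nat.
by apply: complexI; rewrite modulusE normr_nat rmorph_nat.
Qed.

Lemma modulusX x n : modulus (x ^+ n) = modulus x ^+ n.
Proof. by elim: n => [|n IHn]; rewrite ?expr0 ?modulus1 // !exprS modulusM IHn. Qed.

Lemma modulus_sign (b : bool) : modulus ((-1) ^+ b : K) = 1.
Proof.
case: b; rewrite ?expr0 ?expr1 ?modulus1 //.
apply/eqP; rewrite -(eqrXn2 (n := 2)) ?modulus_ge0 //.
by rewrite -modulusX sqrrN !expr1n modulus1.
Qed.

Lemma modulus_prod (I : Type) (r : seq I) (P : pred I) (F : I -> K) :
  modulus (\prod_(i <- r | P i) F i) = \prod_(i <- r | P i) modulus (F i).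
Proof. exact: (big_morph _ modulusM modulus1). Qed.

Lemma modulus_sum (I : Type) (r : seq I) (P : pred I) (F : I -> K) :
  modulus (\sum_(i <- r | P i) F i) <= \sum_(i <- r | P i) modulus (F i).
Proof.
elim/big_rec2: _ => [|i a x _ xa]; first by rewrite modulus0.
by apply: le_trans (modulusD _ _) _; rewrite lerD2l.
Qed.

Lemma normr_le_nat x n : (`|x| <= n%:R) = (modulus x <= n%:R).
Proof. by rewrite -[n%:R in LHS]normr_nat normr_modulus modulus_nat. Qed.

Lemma c0_normr_le1 (x : c0 K) :
  (forall j, modulus (c0_val x j) <= 1) -> `|x| <= 1.
Proof.
move=> x1; have [j xj _] := c0_norm_attained x.
by rewrite [leLHS]xj (normr_le_nat _ 1) x1.
Qed.

Lemma c0_normr_le1_modulus (x : c0 K) j : `|x| <= 1 -> modulus (c0_val x j) <= 1.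
Proof.
by move=> x1; rewrite -(normr_le_nat _ 1); apply: le_trans (le_c0_norm x j) x1.
Qed.

End Scalars.

(** * The upper bound for the coefficients *)

Lemma word_form_scale (K : numFieldType) (I L T : finType) (tau : L -> I)
    (b : {ffun L -> T} -> K) (a : K) (x : I -> T -> K) :
  word_form tau b (fun i t => a * x i t) = a ^+ #|L| * word_form tau b x.
Proof.
rewrite /word_form mulr_sumr; apply: eq_bigr => s _.
by rewrite big_split prodr_const /= mulrCA.
Qed.

Section UpperBound.
Variables (R : realType) (k : scalar_kind) (m : nat) (n : 'I_m -> nat).
Local Notation K := (scalars R k).
Local Notation L := (slot n).
Local Notation M := #|{: L}|.
Local Notation tg := (@tag 'I_m (fun i => 'I_(n i))).
Variables (P : ('I_m -> c0 K) -> K) (B : R).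
Hypothesis homP :
  multihomogeneous_polynomial n (P : (forall i : 'I_m, c0 K) -> K^o).
Hypothesis PB : (poly_norm P <= B%:E)%E.
Hypothesis M_gt0 : (0 < M)%N.

Lemma modulus_le_poly_norm x : (forall i, `|x i| <= 1) -> modulus (P x) <= B.
Proof.
move=> x1; rewrite -lee_fin; apply: le_trans PB.
by apply: ereal_sup_ubound; exists x.
Qed.

Definition polarization_bound : R := 2 ^+ M * (M%:R ^+ M * B).

(** The signed sums have norm at most M, and P is homogeneous of total
    degree M. *)
Lemma polarized_value_le J (y : L -> c0 K) :
  (forall l, supported_below J.+1 (y l)) ->
  (forall l j, modulus (c0_val (y l) j) <= 1) ->
  modulus (polarized_value P y) <= polarization_bound.
Proof.
move=> yJ y1; have [b bE] := multihomogeneous_expansion J homP.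
rewrite /polarized_value; apply: le_trans (modulus_sum _ _ _) _.
rewrite /polarization_bound -natrX.
have -> : (2 ^ M)%N = #|{: {ffun L -> bool}}| by rewrite card_ffun card_bool.
rewrite mulr_natl -sumr_const; apply: ler_sum => e _.
rewrite modulusM modulus_prod big1 ?mul1r => [|l _]; last exact: modulus_sign.
set x := fun i => _.
have M0 : (M%:R : K) != 0 by rewrite pnatr_eq0 -lt0n.
(* the signed sums x i have norm at most M; z is in the unit ball *)
pose z i := M%:R^-1 *: x i.
have xJ i : supported_below J.+1 (x i).
  move=> j Jj; rewrite /x c0_val_sum big1 // => l _.
  by rewrite c0_valZ yJ ?mulr0.
have zJ i : supported_below J.+1 (z i).
  by move=> j Jj; rewrite c0_valZ xJ ?mulr0.
have xz i j : c0_val (x i) j = M%:R * c0_val (z i) j.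
  by rewrite c0_valZ mulrA mulfV ?mul1r.
have -> : P x = M%:R ^+ M * P z.
  transitivity (word_form tg b (@coordinates _ m J x)); first exact: bE.
  rewrite (_ : P z = word_form tg b (@coordinates _ m J z)); last exact: bE.
  rewrite -word_form_scale; congr (word_form _ _ _).
  by apply/funext => i; apply/funext => j; apply: xz.
rewrite modulusM modulusX modulus_nat ler_wpM2l ?exprn_ge0 ?ler0n //.
apply: modulus_le_poly_norm => i; apply: c0_normr_le1 => j.
have := xz i j; rewrite /x c0_val_sum => /(congr1 (@modulus R k)).
rewrite modulusM modulus_nat => Mz.
rewrite -(ler_pM2l (x := M%:R)) ?ltr0n // mulr1 -Mz.
apply: le_trans (modulus_sum _ _ _) _.
apply: (@le_trans _ _ (\sum_(l : L) (1 : R))); last first.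
  by rewrite sumr_const.
rewrite big_mkcond; apply: ler_sum => l _; case: ifP => // _.
by rewrite c0_valZ modulusM modulus_sign mul1r.
Qed.

Definition symmetrized_coefficient J (s : {ffun L -> 'I_J.+1}) : K :=
  polarized_value P (fun l => unit_vector K (nat_word s l)).

Lemma prod_sign (I : finType) (b : I -> bool) (A : pzRingType) :
  \prod_i (-1) ^+ b i = (-1) ^+ odd (\sum_i b i) :> A.
Proof. by rewrite signr_odd prodrXr. Qed.

(** By multilinearity the sum is the polarized value at the sign vectors w l. *)
Lemma signed_sum_symmetrized J (w : {ffun L -> {ffun 'I_J.+1 -> bool}}) :
  modulus (\sum_(s : {ffun L -> 'I_J.+1})
    (\prod_l (-1) ^+ w l (s l)) * symmetrized_coefficient s : K)
    <= polarization_bound.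
Proof.
have [b bE] := multihomogeneous_expansion J homP.
pose y (l : L) := truncation J.+1 (fun j => (-1) ^+ w l (inord j) : K).
have yJ l : supported_below J.+1 (y l) by apply: truncation_supported.
have y1 l j : modulus (c0_val (y l) j) <= 1.
  by rewrite /=; case: ifP; rewrite ?modulus_sign ?modulus0.
apply: le_trans (polarized_value_le yJ y1); rewrite le_eqVlt; apply/orP; left.
apply/eqP; congr modulus; rewrite (polarized_valueE bE yJ).
rewrite polarization_multilinear; apply: eq_bigr => s _.
rewrite /symmetrized_coefficient (polarized_value_unit _ bE) mulrC; congr (_ * _).
by apply: eq_bigr => l _; rewrite /= ltn_ord inord_val.
Qed.

Lemma re_part_sign_bounded J : sign_bounded
  (fun s : {ffun L -> 'I_J.+1} => re_part (symmetrized_coefficient s))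
  polarization_bound.
Proof.
move=> w; apply: le_trans (signed_sum_symmetrized w).
apply: le_trans (re_part_le _); rewrite re_part_sum le_eqVlt; apply/orP; left.
apply/eqP; congr `|_|; apply: eq_bigr => s _.
by rewrite !prod_sign re_part_sign mulrC.
Qed.

Lemma im_part_sign_bounded J : sign_bounded
  (fun s : {ffun L -> 'I_J.+1} => im_part (symmetrized_coefficient s))
  polarization_bound.
Proof.
move=> w; apply: le_trans (signed_sum_symmetrized w).
apply: le_trans (im_part_le _); rewrite im_part_sum le_eqVlt; apply/orP; left.
apply/eqP; congr `|_|; apply: eq_bigr => s _.
by rewrite !prod_sign im_part_sign mulrC.
Qed.

Variable p : R.
Hypothesis p_gt0 : 0 < p.
Hypothesis p_ge : 2 * M%:R / (M%:R + 1) <= p.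
Hypothesis B_gt0 : 0 < B.

Lemma polarization_bound_gt0 : 0 < polarization_bound.
Proof. by rewrite mulr_gt0 ?mulr_gt0 ?exprn_gt0 ?ltr0n. Qed.

(** The factors 2 come from estimating a modulus by twice the larger of its real
    and imaginary parts, and from adding the two resulting sums. *)
Lemma symmetrized_power_sum J :
  \sum_(s : {ffun L -> 'I_J.+1}) modulus (symmetrized_coefficient s) `^ p <=
  2 `^ p * (2 * (khinchine_constant R L * polarization_bound) `^ p).
Proof.
have pb0 := polarization_bound_gt0.
have := bohnenblust_hille_array M_gt0 pb0 p_ge (@im_part_sign_bounded J).
have := bohnenblust_hille_array M_gt0 pb0 p_ge (@re_part_sign_bounded J).
set Q := (_ * _) `^ p => reQ imQ.
apply: (@le_trans _ _ (\sum_(s : {ffun L -> 'I_J.+1}) 2 `^ p *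
    (`|re_part (symmetrized_coefficient s)| `^ p +
     `|im_part (symmetrized_coefficient s)| `^ p))).
  apply: ler_sum => s _; set z := symmetrized_coefficient s.
  pose t := Num.max `|re_part z| `|im_part z|.
  have zt : modulus z <= 2 * t.
    apply: le_trans (modulus_le_parts z) _.
    by rewrite mulr2n mulrDl mul1r lerD // le_max lexx ?orbT.
  have t0 : 0 <= t by rewrite le_max normr_ge0.
  apply: (@le_trans _ _ ((2 * t) `^ p)).
    by rewrite ge0_ler_powR ?nnegrE ?modulus_ge0 ?mulr_ge0 // ltW.
  rewrite powRM // ler_wpM2l ?powR_ge0 //.
  by rewrite /t /Num.max; case: ifP => _; rewrite ?lerDl ?lerDr powR_ge0.
rewrite -mulr_sumr big_split /= ler_wpM2l ?powR_ge0 //.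
by rewrite mulr2n mulrDl mul1r lerD.
Qed.

Lemma sum_uniq_le (S : finType) (q : seq S) (g : S -> R) :
  uniq q -> (forall s, 0 <= g s) -> \sum_(s <- q) g s <= \sum_s g s.
Proof.
move=> uq g0; rewrite big_uniq // [leRHS](bigID (mem q)) /= lerDl.
exact: sumr_ge0.
Qed.

(** A coefficient is bounded by the symmetrized coefficient of its canonical
    word, and distinct multi-indices have distinct canonical words. *)
Lemma coefficient_power_esum :
  (\esum_(a in multidegree n) (modulus (coefficient n P a) `^ p)%:E <=
   (2 `^ p * (2 * (khinchine_constant R L * polarization_bound) `^ p))%:E)%E.
Proof.
apply: ge_ereal_sup => _ [A [finA An] <-].
rewrite fsbig_finite //= sumEFin lee_fin.
pose J := (\max_(a <- fset_set A) \max_l canonical_word (n := n) a l)%N.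
pose f a : {ffun L -> 'I_J.+1} := [ffun l => inord (canonical_word (n := n) a l)].
have inA a : a \in fset_set A -> A a by rewrite in_fset_set // => /set_mem.
have fE a : a \in fset_set A -> nat_word (f a) = canonical_word a.
  move=> aA; apply/funext => l; rewrite /nat_word ffunE inordK // ltnS.
  apply: (@leq_trans (\max_l canonical_word (n := n) a l)); first exact: leq_bigmax.
  by rewrite /J (big_rem a) //= leq_maxl.
have fK a : a \in fset_set A -> word_index (nat_word (f a)) = a.
  by move=> aA; rewrite fE // canonical_wordK //; apply/An/inA.
apply: le_trans (symmetrized_power_sum J).
apply: (@le_trans _ _ (\sum_(s <- map f (fset_set A))
    modulus (symmetrized_coefficient s) `^ p)); last first.
  apply: sum_uniq_le => [|s]; last exact: powR_ge0.
  rewrite map_inj_in_uniq ?fset_uniq // => a a' aA a'A faa.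
  by rewrite -(fK a) // faa fK.
rewrite big_map big_seq [leRHS]big_seq; apply: ler_sum => a aA.
have sf : is_canonical_word (nat_word (f a)) by apply/canonical_wordP; rewrite fK ?fE.
rewrite ge0_ler_powR ?nnegrE ?modulus_ge0 ?(ltW p_gt0) //.
rewrite /symmetrized_coefficient -coefficient_polarized // fK //.
rewrite modulusM modulus_nat ler_peMl ?modulus_ge0 // ler1n muln_gt0.
by rewrite expn_gt0 canonical_symmetries_gt0.
Qed.

End UpperBound.

Lemma poly_norm_ge0 (R : realType) (k : scalar_kind) (m : nat)
    (P : ('I_m -> c0 (scalars R k)) -> scalars R k) : (0 <= poly_norm P)%E.
Proof.
apply: (@le_trans _ _ (modulus (P (fun=> 0)))%:E).
  by rewrite lee_fin modulus_ge0.
by apply: ereal_sup_ubound; exists (fun=> 0) => //= i; rewrite normr0.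
Qed.

(** The polynomial Bohnenblust-Hille inequality for several variables. The norm
    of P may be 0, so the estimate is first proved for every positive upper bound
    of the norm. *)
Theorem bohnenblust_hille (R : realType) (k : scalar_kind) (m : nat)
    (n : 'I_m -> nat) (p : R) : (0 < #|{: slot n}|)%N -> 0 < p ->
  2 * #|{: slot n}|%:R / (#|{: slot n}|%:R + 1) <= p ->
  exists C : R, 1 <= C /\
    forall P : ('I_m -> c0 (scalars R k)) -> scalars R k,
    multihomogeneous_polynomial n
      (P : (forall i : 'I_m, c0 (scalars R k)) -> (scalars R k)^o) ->
    (((\esum_(a in multidegree n) (modulus (coefficient n P a) `^ p)%:E)
           `^ p^-1) <= C%:E * poly_norm P)%E.
Proof.
move=> M0 p0 pge; set M := #|_| in M0 pge.
pose kappa : R := 2 * (2 `^ p^-1 * (khinchine_constant R (slot n) * (2 ^+ M * M%:R ^+ M))).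
exists (Num.max 1 kappa); split; first by rewrite le_max lexx.
move=> P homP; set S := (\esum_(a in _) _)%E.
have k0 : 0 <= khinchine_constant R (slot n).
  by rewrite mulr_ge0 // sqrtr_ge0.
have kappa_ge0 : 0 <= kappa.
  by rewrite !mulr_ge0 // ?powR_ge0 ?exprn_ge0 ?ler0n.
have p_neq0 : p != 0 by rewrite gt_eqF.
have S0 : (0 <= S)%E by apply: esum_ge0 => a _; rewrite lee_fin powR_ge0.
have bound (B : R) : 0 < B -> (poly_norm P <= B%:E)%E ->
    (S `^ p^-1 <= (kappa * B)%:E)%E.
  move=> B0 PB; have := coefficient_power_esum homP PB M0 p0 pge B0.
  rewrite -/S; set X := _ * polarization_bound _ _ => SX.
  have X0 : 0 <= X.
    by rewrite /X mulr_ge0 // !mulr_ge0 ?exprn_ge0 ?ler0n // ltW.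
  have -> : kappa * B = (2 `^ p * (2 * X `^ p)) `^ p^-1.
    rewrite powRM ?mulr_ge0 ?powR_ge0 // powRM ?powR_ge0 // -!powRrM.
    by rewrite mulfV // !powRr1 // /kappa /X /polarization_bound; ring.
  rewrite -poweR_EFin; apply: gt0_ler_poweR => //.
  - by rewrite invr_ge0 ltW.
  - by rewrite in_itv /= S0 leey.
  - by rewrite in_itv /= leey andbT lee_fin !mulr_ge0 ?powR_ge0.
have := poly_norm_ge0 P; case E : (poly_norm P) => [r| |] // r0; last first.
  by rewrite mulry gtr0_sg ?mul1e ?leey // lt_max ltr01.
apply: (@le_trans _ _ (kappa * r)%:E); last first.
  by rewrite -EFinM lee_fin ler_wpM2r // le_max lexx orbT.
apply/lee_addgt0Pr => e e0.
have c1 : 0 < kappa + 1 by rewrite ltr_wpDl.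
have re0 : 0 < r + e / (kappa + 1) by rewrite ltr_wpDl ?divr_gt0.
apply: le_trans (bound _ re0 _) _.
  by rewrite E lee_fin lerDl ltW ?divr_gt0.
rewrite -EFinD lee_fin mulrDr lerD2l mulrCA ger_pMr //.
by rewrite ler_pdivrMr // mul1r lerDl.
Qed.

(** * Walsh forms *)

Section WalshForms.
Variables (R : realType) (k : scalar_kind) (r : nat).
Local Notation K := (scalars R k).
Local Notation V := {ffun 'I_r -> bool}.

Definition walsh (u v : V) : bool := odd (\sum_i (u i && v i)).

Lemma walsh_orthogonal (v w : V) :
  \sum_u (-1) ^+ walsh u v * (-1) ^+ walsh u w =
  (if v == w then 2 ^+ r else 0) :> R.
Proof.
rewrite (eq_bigr (fun u : V => \prod_i
    ((-1) ^+ (u i && v i) * (-1) ^+ (u i && w i)))); last first.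
  by move=> u _; rewrite big_split /= !prod_sign.
rewrite -(bigA_distr_bigA (fun i (b : bool) =>
  (-1) ^+ (b && v i) * (-1) ^+ (b && w i))) /=.
have E i : \sum_(b : bool) (-1) ^+ (b && v i) * (-1) ^+ (b && w i) =
    (if v i == w i then 2 else 0) :> R.
  by rewrite big_bool /=; case: (v i); case: (w i); rewrite /= ?expr0 ?expr1; ring.
under eq_bigr do rewrite E.
case: eqVneq => [->|vw].
  under eq_bigr do rewrite eqxx.
  by rewrite prodr_const card_ord.
have /existsP[i vwi] : [exists i, v i != w i].
  by rewrite -negb_forall; apply: contraNN vw => /forallP h; apply/eqP/ffunP => i;
    apply/eqP.
by rewrite (bigD1 i) //= (negPf vwi) mul0r.
Qed.

Lemma walsh_isometry_real (y : V -> R) :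
  \sum_u (\sum_v (-1) ^+ walsh u v * y v) ^+ 2 = 2 ^+ r * \sum_v y v ^+ 2.
Proof.
transitivity (\sum_v \sum_w (y v * y w) *
    \sum_u (-1) ^+ walsh u v * (-1) ^+ walsh u w : R).
  under [RHS]eq_bigr => v _ do
    (under eq_bigr => w _ do rewrite mulr_sumr; rewrite exchange_big).
  rewrite [RHS]exchange_big; apply: eq_bigr => u _.
  rewrite expr2 mulr_suml; apply: eq_bigr => v _.
  by rewrite mulr_sumr; apply: eq_bigr => w _; ring.
rewrite mulr_sumr; apply: eq_bigr => v _.
rewrite (bigD1 v) //= walsh_orthogonal eqxx big1 => [|w wv]; first by ring.
by rewrite walsh_orthogonal eq_sym (negPf wv) mulr0.
Qed.

Lemma walsh_isometry (y : V -> K) :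
  \sum_u modulus (\sum_v (-1) ^+ walsh u v * y v) ^+ 2 =
  2 ^+ r * \sum_v modulus (y v) ^+ 2.
Proof.
under eq_bigr do rewrite sqr_modulus re_part_sum im_part_sum.
rewrite big_split /=.
under eq_bigr do under eq_bigr do rewrite re_part_sign.
under [X in _ + X]eq_bigr do under eq_bigr do rewrite im_part_sign.
rewrite !walsh_isometry_real -mulrDr -big_split /=; congr (_ * _).
by apply: eq_bigr => v _; rewrite sqr_modulus.
Qed.

(** The vector of values G satisfies G_0 = 1 and G_(M+1) = H (X_0 G_M), where H is
    the Walsh matrix, sqrt (2^r) times an isometry, and X_0 acts as a diagonal
    contraction. The induction is on the square of the Euclidean norm of G. *)
Lemma walsh_chain M : exists b : V -> {ffun 'I_M -> V} -> bool,
  forall X : 'I_M -> V -> K, (forall i v, modulus (X i v) <= 1) ->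
  \sum_v modulus (\sum_h (-1) ^+ b v h * \prod_i X i (h i)) ^+ 2 <=
  (2 ^+ r) ^+ M.+1.
Proof.
elim: M => [|M [b bE]].
  exists (fun _ _ => false) => X _; rewrite expr1.
  have E : \sum_(h : {ffun 'I_0 -> V}) (-1) ^+ false * \prod_i X i (h i) = 1.
    rewrite (eq_bigr (fun=> 1)) => [|h _]; last by rewrite big_ord0 mulr1.
    by rewrite sumr_const card_ffun card_ord expn0.
  rewrite E modulus1 expr1n sumr_const card_ffun card_bool card_ord.
  by rewrite natrX.
exists (fun v h => walsh v (unconsf h).1 (+) b (unconsf h).1 (unconsf h).2) => X X1.
pose G w := \sum_h (-1) ^+ b w h * \prod_i X (lift ord0 i) (h i) : K.
have E v : \sum_h (-1) ^+ (walsh v (unconsf h).1 (+)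
      b (unconsf h).1 (unconsf h).2) * \prod_i X i (h i) =
    \sum_w (-1) ^+ walsh v w * (X ord0 w * G w).
  rewrite (reindex _ (onW_bij _ (consf_bij V M))) /=.
  transitivity (\sum_w \sum_h (-1) ^+ walsh v w * (X ord0 w * ((-1) ^+ b w h *
      \prod_i X (lift ord0 i) (h i)))).
    rewrite pair_bigA /=; apply: eq_bigr => -[w h] _ /=.
    have -> : [ffun i => consf w h (lift ord0 i)] = h.
      by apply/ffunP => i; rewrite ffunE consfS.
    rewrite big_ord_recl consf0.
    rewrite [X in _ * (_ * X)](eq_bigr (fun i => X (lift ord0 i) (h i))).
      by rewrite signr_addb; ring.
    by move=> i _; rewrite consfS.
  by apply: eq_bigr => w _; rewrite -mulr_sumr -mulr_sumr.
under eq_bigr do rewrite E.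
rewrite walsh_isometry [leRHS]exprS ler_wpM2l ?exprn_ge0 //.
apply: le_trans (bE (fun i => X (lift ord0 i)) _) => //.
apply: ler_sum => w _; rewrite modulusM exprMn -[leRHS]mul1r.
by rewrite ler_wpM2r ?sqr_ge0 // exprn_ile1 ?modulus_ge0.
Qed.

(** A single entry of the vector of the previous lemma is bounded by its norm. *)
Lemma walsh_form (L : finType) : exists b : {ffun L -> V} -> bool,
  forall X : L -> V -> K, (forall l v, modulus (X l v) <= 1) ->
  modulus (\sum_h (-1) ^+ b h * \prod_l X l (h l)) ^+ 2 <=
  (2 ^+ r) ^+ #|L|.+1.
Proof.
have [b bE] := walsh_chain #|L|; pose v0 : V := [ffun=> false].
pose e (h : {ffun L -> V}) : {ffun 'I_#|L| -> V} := [ffun i => h (enum_val i)].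
exists (fun h => b v0 (e h)) => X X1.
apply: le_trans (bE (fun i => X (enum_val i)) _) => //.
rewrite (bigD1 v0) //= -[leLHS]addr0 lerD ?sumr_ge0 // => [|v _]; last exact: sqr_ge0.
rewrite le_eqVlt; apply/orP; left; apply/eqP; congr (modulus _ ^+ _).
rewrite [RHS](reindex _ (onW_bij _ (enumf_bij L V))) /=.
apply: eq_bigr => h _; congr (_ * _).
rewrite (reindex (@enum_val L predT)) /=; last first.
  by exists enum_rank => l _; rewrite ?enum_rankK ?enum_valK.
by apply: eq_bigr => i _; rewrite ffunE.
Qed.

End WalshForms.

(** * Polynomials given by words *)

Section WordPolynomials.
Variables (K : numFieldType) (m : nat) (n : 'I_m -> nat).
Local Notation L := (slot n).
Variables (G : finType) (c : G -> K) (w : G -> L -> nat).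

Definition word_polynomial (x : 'I_m -> c0 K) : K :=
  \sum_g c g * \prod_l c0_val (x (tag l)) (w g l).

Lemma coordinate_continuous j : continuous (fun x : c0 K => c0_val x j : K^o).
Proof.
move=> x; apply/(@cvgrPdist_lt _ K^o _ (nbhs x) (nbhs_filter x)) => e e0.
have near_x : \forall y \near x, `|x - y| < e by apply/nbhs_normP; exists e.
apply: (@filterS _ (nbhs x) (nbhs_filter x) _ _ _ near_x) => y.
exact: le_lt_trans (le_c0_norm (x - y) j).
Qed.

Lemma word_polynomial_continuous :
  continuous (word_polynomial : {ptws 'I_m -> c0 K} -> K).
Proof.
have coord_cont l g : continuous
    (fun x : {ptws 'I_m -> c0 K} => c0_val (x (tag (l : L))) (w g l) : K).
  move=> x; apply: (@continuous_comp _ _ _ (fun y : {ptws 'I_m -> c0 K} => y (tag l))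
    (fun z : c0 K => c0_val z (w g l) : K)).
    exact: (@proj_continuous _ (fun _ : 'I_m => c0 K) (tag l) x).
  exact: coordinate_continuous.
have add_cont : continuous (fun z : K * K => z.1 + z.2).
  exact: (@add_continuous K^o).
have prod_cont g : continuous
    (fun x : {ptws 'I_m -> c0 K} => \prod_l c0_val (x (tag (l : L))) (w g l) : K).
  apply: (@continuous_big K L *%R 1 xpredT (@mul_continuous K)
    {ptws 'I_m -> c0 K} (index_enum L) (fun l x => c0_val (x (tag l)) (w g l))).
  by move=> l _; apply: coord_cont.
have scale_cont (T : topologicalType) (a : K) (f : T -> K) :
    continuous f -> continuous (fun x => a * f x).
  by move=> fc x; apply: (cvg_comp _ _ (fc x)); apply: mulrl_continuous.
apply: (@continuous_big K G +%R 0 xpredT add_cont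
  {ptws 'I_m -> c0 K} (index_enum G)
  (fun g x => c g * \prod_l c0_val (x (tag l)) (w g l))) => g _.
exact: (scale_cont _ (c g) _ (prod_cont g)).
Qed.

(** The multilinear map in the variable i substitutes its k-th argument in the
    slot (i, k) and keeps the other variables in their slots. *)
Lemma word_polynomial_homogeneous :
  multihomogeneous_polynomial n
    (word_polynomial : (forall i : 'I_m, c0 K) -> K^o).
Proof.
move=> i x.
pose y (z : 'I_(n i) -> c0 K) (l : L) : c0 K := untag (x (tag l)) z l.
exists (fun z => \sum_g c g * \prod_l c0_val (y z l) (w g l) : K^o); last first.
  move=> t; apply: eq_bigr => g _; congr (_ * _); apply: eq_bigr => l _.
  congr (c0_val _ _); rewrite /y; have [li|il] := eqVneq (tag l) i.
    by rewrite (untagE _ _ li) li dfwithin.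
  by rewrite untag_dflt // dfwithout // eq_sym.
move=> q z a s t.
pose l0 : L := Tagged (fun i => 'I_(n i)) q.
have yE l u : y (dfwith z q u) l = if l == l0 then u else y z l.
  rewrite /y; case: eqP => [->|ll0]; first by rewrite untagE /= dfwithin.
  have [li|il] := eqVneq (tag l) i; last by rewrite !untag_dflt.
  rewrite !(untagE _ _ li) dfwithout //; apply/eqP => ql; apply: ll0.
  by rewrite /l0 ql; case: l li {ql} => j v /= li; case: _ / li.
have E u : \sum_g c g * \prod_l c0_val (y (dfwith z q u) l) (w g l) =
    \sum_g c0_val u (w g l0) *
      (c g * \prod_(l | l != l0) c0_val (y z l) (w g l)).
  apply: eq_bigr => g _; rewrite (bigD1 l0) //= yE eqxx mulrCA; congr (_ * (_ * _)).
  by apply: eq_bigr => l /negPf ll0; rewrite yE ll0.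
rewrite !E scaler_sumr -big_split; apply: eq_bigr => g _.
by rewrite c0_valD c0_valZ mulrDl -mulrA.
Qed.

End WordPolynomials.

(** * Optimality of the exponent *)

Section WalshPolynomial.
Variables (R : realType) (k : scalar_kind) (m : nat) (n : 'I_m -> nat) (r : nat).
Local Notation K := (scalars R k).
Local Notation L := (slot n).
Local Notation M := #|{: L}|.
Local Notation V := {ffun 'I_r -> bool}.
Local Notation tg := (@tag 'I_m (fun i => 'I_(n i))).

(** Numbering all pairs (l, v) gives every slot its own block of coordinates. *)
Definition cell (l : L) (v : V) : nat := enum_rank (l, v).

Lemma cell_inj l v l' v' : cell l v = cell l' v' -> l = l' /\ v = v'.
Proof. by move=> /val_inj/enum_rank_inj[]. Qed.

Variable b : {ffun L -> V} -> bool.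

Definition walsh_polynomial : ('I_m -> c0 K) -> K :=
  word_polynomial (fun h => (-1) ^+ b h)
    (fun (h : {ffun L -> V}) l => cell l (h l)).

Local Notation P := walsh_polynomial.

Lemma walsh_polynomial_homogeneous : multihomogeneous_polynomial n
  (P : (forall i : 'I_m, c0 K) -> K^o).
Proof. exact: word_polynomial_homogeneous. Qed.

Definition cell_word (h : {ffun L -> V}) :
    {ffun L -> 'I_#|{: L * V}|.+1} :=
  [ffun l => inord (cell l (h l))].

Lemma nat_cell_word h l : nat_word (cell_word h) l = cell l (h l).
Proof. by rewrite /nat_word ffunE inordK //; apply: leqW (ltn_ord _). Qed.

(** The blocks of coordinates of different slots are disjoint. *)
Lemma permute_cell_word h h' (g : {perm L}) :
  cell_word h' = permute_word g (cell_word h) -> g = 1%g /\ h' = h.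
Proof.
move=> /ffunP E; have E1 l : g l = l /\ h' l = h (g l).
  have := congr1 val (E l); rewrite [in RHS]ffunE.
  rewrite -[LHS]/(nat_word (cell_word h') l) -[RHS]/(nat_word (cell_word h) (g l)).
  by rewrite !nat_cell_word => /cell_inj[e1 e2]; split; [exact: esym|].
split; first by apply/perm.permP => l; rewrite perm1; case: (E1 l).
by apply/ffunP => l; have [gl ->] := E1 l; rewrite gl.
Qed.

Lemma walsh_polynomial_word_form (x : 'I_m -> c0 K) :
  P x = word_form tg (fun s => \sum_(h | cell_word h == s) (-1) ^+ b h)
          (@coordinates K m #|{: L * V}| x).
Proof.
rewrite /word_form -(sum_fibers cell_word (fun h => (-1) ^+ b h)
  (fun s => \prod_l coordinates x (tag l) (s l))).
apply: eq_bigr => h _; congr (_ * _); apply: eq_bigr => l _.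
by rewrite -(nat_cell_word h).
Qed.

(** The letters of a cell word are distinct and determine their slots, so only
    the identity contributes to the symmetrized coefficient, and exactly one
    permutation makes the word canonical. *)
Lemma walsh_polynomial_coefficient h :
  modulus (coefficient n P (word_index (nat_word (cell_word h)))) = 1.
Proof.
have := coefficient_polarized (cell_word h) walsh_polynomial_homogeneous.
rewrite (polarized_value_unit _ (fun x _ => walsh_polynomial_word_form x)).
rewrite polarization_delta (bigD1 1%g) /=; last first.
  by rewrite inE; apply/forallP => l; rewrite perm1.
rewrite [X in _ + X]big1 => [|g /andP[_ g1]]; last first.
  rewrite big_pred0 // => h'; apply/negP => /eqP /permute_cell_word[].
  by move/eqP; rewrite (negPf g1).
have -> : permute_word 1 (cell_word h) = cell_word h.
  by apply/ffunP => l; rewrite ffunE perm1.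
rewrite (big_pred1 h) => [|h']; last first.
  apply/eqP/eqP => [E|-> //]; apply: (proj2 (@permute_cell_word h h' 1%g _)).
  by rewrite E; apply/ffunP => l; rewrite [in RHS]ffunE perm1.
rewrite addr0 natrM natrX -mulrA => /(mulfI _) E.
have {E} : modulus ((canonical_symmetries (nat_word (cell_word h)))%:R *
    coefficient n P (word_index (nat_word (cell_word h)))) = 1.
  by rewrite E ?modulus_sign // expf_neq0 // pnatr_eq0.
rewrite modulusM modulus_nat.
have : (canonical_symmetries (nat_word (cell_word h)) <= 1)%N.
  apply/card_le1P => g /andP[gt /canonical_wordP gs] g'; rewrite [RHS]inE.
  apply/idP/eqP => [/andP[gt' /canonical_wordP gs']|->]; last first.
    by apply/andP; split => //; apply/canonical_wordP.
  move: gs gs'; rewrite !word_index_permute; last 2 first.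
  - by move=> l; apply/eqP/(forallP gt').
  - by move=> l; apply/eqP/(forallP gt).
  move=> -> /(congr1 (fun f => f _)) E; apply/perm.permP => l.
  by have := E l; rewrite /= !nat_cell_word => /cell_inj[].
case: canonical_symmetries => [_ /eqP|[|//] _]; last by rewrite mul1r.
by rewrite mul0r eq_sym oner_eq0.
Qed.

Lemma word_index_cell_inj :
  injective (fun h => word_index (nat_word (cell_word h))).
Proof.
move=> h h' E; apply/ffunP => l.
have : (0 < word_index (nat_word (cell_word h)) (tag l) (cell l (h l)))%N.
  by rewrite word_indexE (bigD1 l) //= nat_cell_word eqxx.
rewrite [word_index _]E word_indexE lt0n sum_nat_eq0 => /forallPn[l'].
rewrite negb_imply eqb0 negbK nat_cell_word => /andP[_ /eqP /cell_inj[ll]].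
by rewrite ll.
Qed.

Lemma walsh_polynomial_esum (p : R) :
  (((2 ^+ r) ^+ M)%:E <=
   \esum_(a in multidegree n) (modulus (coefficient n P a) `^ p)%:E)%E.
Proof.
pose q := [seq word_index (nat_word (cell_word h)) | h <- index_enum {ffun L -> V}].
apply: esum_ge; exists [set` q].
  split; first exact: finite_seq.
  by move=> a /= /mapP[h _ ->]; apply: word_index_multidegree.
rewrite -fsbig_seq ?map_inj_uniq ?index_enum_uniq //; last exact: word_index_cell_inj.
rewrite big_map sumEFin lee_fin.
under eq_bigr do rewrite walsh_polynomial_coefficient powR1.
by rewrite sumr_const !card_ffun card_bool card_ord !natrX.
Qed.

Lemma walsh_polynomial_norm :
  (forall X : L -> V -> K, (forall l v, modulus (X l v) <= 1) ->
    modulus (\sum_h (-1) ^+ b h * \prod_l X l (h l)) ^+ 2 <= (2 ^+ r) ^+ M.+1) ->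
  (poly_norm P <= (Num.sqrt ((2 ^+ r) ^+ M.+1))%:E)%E.
Proof.
move=> bE; apply: ge_ereal_sup => _ [x /= x1 <-]; rewrite lee_fin.
rewrite -[leLHS](ger0_norm (modulus_ge0 _)) -sqrtr_sqr ler_wsqrtr //.
apply: (bE (fun l v => c0_val (x (tag l)) (cell l v))) => l v.
exact: c0_normr_le1_modulus.
Qed.

End WalshPolynomial.

(** If d = 2M/p - (M + 1) were positive, the powers of 2^d would be bounded by
    C^2. *)
Theorem summability_exponent_ge (R : realType) (k : scalar_kind) (m : nat)
    (n : 'I_m -> nat) (p C : R) : 0 < p -> 1 <= C ->
  (forall P : {ptws 'I_m -> c0 (scalars R k)} -> scalars R k,
    multihomogeneous_polynomial n
      (P : (forall i : 'I_m, c0 (scalars R k)) -> (scalars R k)^o) ->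
    continuous P ->
    (((\esum_(a in multidegree n) (modulus (coefficient n P a) `^ p)%:E)
       `^ p^-1) <= C%:E * poly_norm P)%E) ->
  2 * #|{: slot n}|%:R / (#|{: slot n}|%:R + 1) <= p.
Proof.
move=> p0 C1 HC; set M := #|_|.
have bound r : (2 ^+ r) `^ (M%:R / p) <= C * Num.sqrt ((2 ^+ r) ^+ M.+1) :> R.
  have [b bE] := @walsh_form R k r (slot n).
  have := HC (@walsh_polynomial R k m n r b)
    (@walsh_polynomial_homogeneous R k m n r b)
    (@word_polynomial_continuous _ _ _ _ _ _).
  have := walsh_polynomial_norm bE; set N := poly_norm _ => NE H.
  rewrite -lee_fin EFinM; apply: le_trans (lee_wpmul2l _ NE); last first.
    by rewrite lee_fin (le_trans ler01).
  apply: le_trans H; rewrite powRrM powR_mulrn ?exprn_ge0 // -poweR_EFin.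
  have E := @walsh_polynomial_esum R k m n r b p.
  apply: gt0_ler_poweR E; rewrite ?invr_ge0 ?(ltW p0) // in_itv /= leey andbT.
    by rewrite lee_fin !exprn_ge0.
  by apply: esum_ge0 => a _; rewrite lee_fin powR_ge0.
rewrite leNgt; apply/negP => pM.
have M1 : 0 < M%:R + 1 :> R by rewrite ltr_wpDl ?ler0n.
pose d : R := 2 * (M%:R / p) - (M%:R + 1).
have d0 : 0 < d.
  by rewrite subr_gt0 mulrA ltr_pdivlMr // mulrC -ltr_pdivlMr.
pose t : R := 2 `^ d.
have tr r : t ^+ r <= C ^+ 2.
  have X0 : 0 < 2 ^+ r :> R by rewrite exprn_gt0.
  have -> : t ^+ r = (2 ^+ r) `^ d.
    by rewrite -!powR_mulrn ?powR_ge0 // -!powRrM mulrC.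
  have dE : 2 * (M%:R / p) = d + (M.+1)%:R by rewrite -[M.+1]addn1 natrD /d; ring.
  rewrite -(ler_pM2r (x := (2 ^+ r) ^+ M.+1)) ?exprn_gt0 //.
  rewrite -[X in _ * X <= _]powR_mulrn ?exprn_ge0 // -powRD; last first.
    by apply/implyP => _; rewrite gt_eqF.
  rewrite -dE mulrC powRrM powR_mulrn ?powR_ge0 //.
  rewrite -[X in _ <= _ * X]sqr_sqrtr ?exprn_ge0 // -exprMn.
  by rewrite ler_pXn2r ?nnegrE ?powR_ge0 ?mulr_ge0 ?sqrtr_ge0 ?(le_trans ler01).
have t1 : 1 < t.
  have -> : 1 = 1 `^ d :> R by rewrite powR1.
  by apply: gt0_ltr_powR; rewrite ?nnegrE // ltr1n.
have bern r : 1 + r%:R * (t - 1) <= t ^+ r.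
  elim: r => [|r IHr]; first by rewrite mul0r addr0 expr0.
  rewrite exprS; apply: le_trans (ler_wpM2l _ IHr); last by rewrite ltW // (lt_trans _ t1).
  have r0 : 0 <= r%:R :> R by rewrite ler0n.
  rewrite -subr_ge0 [X in 0 <= X](_ : _ = r%:R * (t - 1) ^+ 2).
    by rewrite mulr_ge0 ?sqr_ge0.
  by rewrite -natr1; ring.
have := archi_boundP (x := C ^+ 2 / (t - 1)).
set r := Num.bound _ => /(_ _) rP.
have := le_trans (bern r) (tr r); apply/negP; rewrite -ltNge.
have : C ^+ 2 / (t - 1) < r%:R by apply: rP; rewrite divr_ge0 ?sqr_ge0 // subr_ge0 ltW.
by rewrite ltr_pdivrMr ?subr_gt0 // => /lt_trans; apply; rewrite ltrDr.
Qed.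

(** * The equivalence *)

Theorem theorem6p3 (R : realType) (k : scalar_kind) (m : nat) (n : 'I_m -> nat)
    (p : R) (m_gt0 : (0 < m)%N) (n_gt0 : forall i, (0 < n i)%N) (p_gt0 : 0 < p) :
  (exists C : R, 1 <= C /\
     forall P : {ptws 'I_m -> c0 (scalars R k)} -> scalars R k,
       multihomogeneous_polynomial n
         (P : (forall i : 'I_m, c0 (scalars R k)) -> (scalars R k)^o) ->
       continuous P ->
       (((\esum_(a in multidegree n) (modulus (coefficient n P a) `^ p)%:E)
           `^ p^-1)
        <= C%:E * poly_norm P)%E)
  <->
  2 * (\sum_(j < m) n j)%N%:R / ((\sum_(j < m) n j)%N%:R + 1) <= p.
Proof.
have M_gt0 : (0 < #|{: slot n}|)%N.
  by rewrite card_slot (bigD1 (Ordinal m_gt0)) //= ltn_addr // n_gt0.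
rewrite -card_slot; split=> [[C [C1 HC]]|p_ge].
  exact: summability_exponent_ge p_gt0 C1 HC.
have [C [C1 HC]] := bohnenblust_hille k M_gt0 p_gt0 p_ge.
by exists C; split=> // P homP _; apply: HC.
Qed.
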